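(* Every string graph $S$, viewed as a metric space with its shortest-path metric $d_S$, has Assouad–Nagata dimension at most $2$.
   Context: A string graph is a graph isomorphic to the intersection graph of a collection $\mathcal{S}$ of path-connected subsets of $\mathbb{R}^2$: vertex set $\mathcal{S}$, distinct members adjacent iff they intersect. $d_S$ is the shortest-path distance (edges of length 1, distance $\infty$ between different components). A metric space $X$ has Assouad–Nagata dimension at most $n$ if there is a constant $c>0$ such that for every $r>0$ there is a cover of $X$ by sets of diameter at most $cr$ such that every ball of radius $r$ intersects at most $n+1$ sets of the cover. *)

(* Defs.v *)
From HB Require Import structures.
From mathcomp Require Import all_boot all_order all_algebra.
From mathcomp Require Import all_classical all_reals all_analysis.

Set Implicit Arguments.
Unset Strict Implicit.
Unset Printing Implicit Defensive.

Import Order.TTheory GRing.Theory Num.Theory.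
Import numFieldNormedType.Exports.

Local Open Scope classical_set_scope.
Local Open Scope ring_scope.
Local Open Scope card_scope.

(* Simple graphs; the vertex type may be infinite. *)
Record graph := Graph {
  vertex :> Type;
  adj : rel vertex;
  adj_sym : symmetric adj;
  adj_irr : irreflexive adj
}.

Definition graph_iso (G H : graph) : Prop :=
  exists2 f : G -> H, bijective f & forall u v, adj (f u) (f v) = adj u v.

Section IntersectionGraph.
Variables (T : Type) (C : set (set T)).

Definition intersection_adj : rel {A : set T | C A} :=
  fun A B => `[< A <> B /\ sval A `&` sval B !=set0 >].

Lemma intersection_adj_sym : symmetric intersection_adj.
Proof.
by move=> A B; apply/asboolP/asboolP => -[AB ?]; rewrite setIC; split=> // /esym.
Qed.

Lemma intersection_adj_irr : irreflexive intersection_adj.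
Proof. by move=> A; apply/asboolP => -[]. Qed.

Definition intersection_graph : graph :=
  Graph intersection_adj_sym intersection_adj_irr.

End IntersectionGraph.

(* The empty set counts as path-connected; it can only contribute one isolated
   vertex to an intersection graph. *)
Definition path_connected (R : realType) (T : topologicalType) (A : set T) :
    Prop :=
  forall x y, A x -> A y ->
    exists g : R -> T, [/\ {within `[0, 1], continuous g}, g 0 = x, g 1 = y &
      g @` `[0, 1] `<=` A].

Definition string_graph (R : realType) (S : graph) : Prop :=
  exists2 C : set (set (R * R)%type), (forall A, C A -> path_connected R A) &
    graph_iso S (intersection_graph C).

(* Metric spaces whose distance may be infinite. *)
Record emetric (R : realType) := EMetric {
  epoint :> Type;
  edist : epoint -> epoint -> \bar R;
  edist_eq0 : forall x y, edist x y = 0%E <-> x = y;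
  edist_sym : forall x y, edist x y = edist y x;
  edist_triangle : forall x y z, (edist x z <= edist x y + edist y z)%E
}.

Section GraphMetric.
Variables (R : realType) (G : graph).
Implicit Types x y z : G.

(* `path` allows repeated vertices, but a walk of minimal length has none.  With
   no walk from x to y the set is empty, and its infimum is +oo. *)
Definition walk_lengths x y : set (\bar R) :=
  [set (size p)%:R%:E | p in [set p : seq G | path (@adj G) x p /\ last x p = y]].

Definition graph_dist x y : \bar R := ereal_inf (walk_lengths x y).

Lemma graph_dist_ge0 x y : (0 <= graph_dist x y)%E.
Proof. by apply: le_ereal_inf_tmp => _ [p _ <-]; rewrite lee_fin. Qed.

Lemma graph_dist_attained x y :
  graph_dist x y = +oo%E \/ walk_lengths x y (graph_dist x y).
Proof.
have [[p [pp pl]]|np] :=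
  pselect (exists p : seq G, path (@adj G) x p /\ last x p = y); last first.
  left; rewrite /graph_dist (_ : walk_lengths x y = set0) ?ereal_inf0 //.
  by apply/seteqP; split=> // e [p pP _]; apply: np; exists p.
right.
pose P n := `[< exists p : seq G, [/\ path (@adj G) x p, last x p = y & size p = n] >].
have exP : exists n, P n by exists (size p); apply/asboolP; exists p.
have [n /asboolP[q [qp ql qn]] nmin] := ex_minnP exP.
suff -> : graph_dist x y = n%:R%:E by exists q => //; rewrite qn.
apply/eqP; rewrite eq_le; apply/andP; split.
  by apply: ereal_inf_lbound; exists q => //; rewrite qn.
apply: le_ereal_inf_tmp => _ [s [sp sl] <-]; rewrite lee_fin ler_nat.
by apply: nmin; apply/asboolP; exists s.
Qed.

Lemma graph_dist_eq0 x y : graph_dist x y = 0%E <-> x = y.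
Proof.
split=> [d0|<-].
  have := graph_dist_attained x y; rewrite d0 => -[//|[p [_ <-]] [] /eqP].
  by rewrite pnatr_eq0; case: p.
apply/eqP; rewrite eq_le graph_dist_ge0 andbT.
by apply: ereal_inf_lbound; exists [::].
Qed.

Lemma graph_dist_sym x y : graph_dist x y = graph_dist y x.
Proof.
suff H u v : walk_lengths u v `<=` walk_lengths v u.
  by rewrite /graph_dist; congr ereal_inf; apply/seteqP; split; apply: H.
move=> _ [p [pp <-] <-]; exists (rev (belast u p)); last first.
  by rewrite size_rev size_belast.
split; first by rewrite rev_path (eq_path (e' := @adj G)) // => a b; rewrite adj_sym.
by case: p pp => //= a p _; rewrite rev_cons last_rcons.
Qed.

Lemma graph_dist_triangle x y z :
  (graph_dist x z <= graph_dist x y + graph_dist y z)%E.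
Proof.
have [->|[p [pp pl] <-]] := graph_dist_attained x y.
  rewrite addye ?leey //.
  by apply/eqP => e; have := graph_dist_ge0 y z; rewrite e.
have [->|[q [qp ql] <-]] := graph_dist_attained y z; first by rewrite addey ?leey.
rewrite -EFinD -natrD -size_cat; apply: ereal_inf_lbound; exists (p ++ q) => //.
by split; rewrite ?cat_path ?last_cat pl ?pp.
Qed.

Definition graph_emetric : emetric R :=
  EMetric graph_dist_eq0 graph_dist_sym graph_dist_triangle.

End GraphMetric.

Section AssouadNagata.
Variables (R : realType) (X : emetric R).

(* Balls are closed. *)
Definition ecball (x : X) (r : R) : set X := [set y | (edist x y <= r%:E)%E].

Definition ediameter (A : set X) : \bar R :=
  ereal_sup [set edist x y | x in A & y in A].

Definition assouad_nagata_dim_le (n : nat) : Prop :=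
  exists2 c : R, 0 < c & forall r : R, 0 < r ->
    exists U : set (set X),
      [/\ \bigcup_(A in U) A = [set: X],
          forall A, U A -> (ediameter A <= (c * r)%:E)%E &
          forall x : X, [set A | U A /\ A `&` ecball x r !=set0] #<= `I_n.+1].

End AssouadNagata.

(* Main.v *)
Require Import Defs.
From Stdlib Require Import Btauto.
From mathcomp Require Import all_boot all_order all_algebra.
From mathcomp Require Import all_classical all_reals all_analysis.
From mathcomp Require Import zify lra.

Set Implicit Arguments.
Unset Strict Implicit.
Unset Printing Implicit Defensive.

Import Order.TTheory GRing.Theory Num.Theory.
Import numFieldNormedType.Exports.

(* It suffices to colour the vertices with three colours so that every
   monochromatic chain with jumps of length at most n has ends at distance O(n):
   the classes of such chains are then the cover.  By compactness (an ultrafilter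
   on the finite sets of vertices) only finitely many strings matter at a time,
   and on a fine mesh these become finite connected sets of cells of Z^2.

   Let f be the distance from a root in the intersection pattern of the cell sets
   and let g be the distance from a root inside an annulus a <= f <= b, where the
   sets crossing the boundary of the annulus are cut into connected pieces.  A
   walk along which g varies by at most w, in an annulus of width at most w, has
   ends at distance O(w).  Otherwise, steepest descents of f and g starting from
   three far apart points related to the walk would draw a K_{3,3} in the grid,
   which is excluded by a parity argument.  Hence each layer of f can be
   two-coloured by the parity of g at any scale, and the colourings of the layers
   fit together with three colours. *)

(** * K_{3,3} is not a minor of the grid *)

Local Open Scope ring_scope.

Definition cell := (int * int)%type.

Definition edge := (bool * cell)%type.
Definition hedge (x y : int) : edge := (true, (x, y)).
Definition vedge (x y : int) : edge := (false, (x, y)).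
Definition src (e : edge) : cell := e.2.
Definition tgt (e : edge) : cell :=
  if e.1 then (e.2.1 + 1, e.2.2) else (e.2.1, e.2.2 + 1).

(* A chain [d] is moved by (1/2, 1/2) before it is intersected with a chain [c]:
   the moved edge [e] then meets exactly one grid edge, [crossed e], and it shares
   an end with that edge. *)
Definition crossed (e : edge) : edge := (~~ e.1, tgt e).

Definition coef (c : seq edge) (e : edge) : bool := odd (count_mem e c).

(** The mod 2 boundary of [c], encoded by its pairing with every set [Q] of cells: the parity of the
    number of boundary points in [Q]. *)
Definition bd (c : seq edge) (Q : pred cell) : bool :=
  \big[addb/false]_(e <- c) (Q (src e) (+) Q (tgt e)).

Definition crossing (c d : seq edge) : bool :=
  \big[addb/false]_(e <- d) coef c (crossed e).

(* The horizontal ray to the right of p + (1/2, 1/2). *)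
Definition ray (c : seq edge) (p : cell) : bool :=
  odd (count (fun e : edge => [&& ~~ e.1, e.2.2 == p.2 & p.1 < e.2.1]) c).

Lemma coef_cat c d e : coef (c ++ d) e = coef c e (+) coef d e.
Proof. by rewrite /coef count_cat oddD. Qed.

Lemma bd_cat c d Q : bd (c ++ d) Q = bd c Q (+) bd d Q.
Proof. by rewrite /bd big_cat. Qed.

Lemma crossing_catr c d1 d2 :
  crossing c (d1 ++ d2) = crossing c d1 (+) crossing c d2.
Proof. by rewrite /crossing big_cat. Qed.

Lemma crossing_catl c1 c2 d :
  crossing (c1 ++ c2) d = crossing c1 d (+) crossing c2 d.
Proof.
by rewrite /crossing -big_split; apply: eq_bigr => e _; rewrite coef_cat.
Qed.

Definition cycle (c : seq edge) := forall Q, bd c Q = false.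

Lemma odd_count_big (T : Type) (P : pred T) (s : seq T) :
  odd (count P s) = \big[addb/false]_(e <- s) P e.
Proof.
by elim: s => [|e s IH]; rewrite ?big_nil // big_cons /= oddD IH; case: (P e).
Qed.

(** A horizontal step shortens the ray by one vertical edge, [crossed e]. For a vertical step, the
    two rays and [crossed e] together are the edges with exactly one end in the half-line [Q], and a
    cycle has evenly many of those. *)
Lemma ray_cycle c e : cycle c ->
  coef c (crossed e) = ray c (src e) (+) ray c (tgt e).
Proof.
case: e => [[] [x y]] cyc; rewrite /coef /ray !odd_count_big -big_split /=.
  apply: eq_bigr => -[[] [x' y']] _ //=.
  by rewrite /crossed /= /tgt /= !xpair_eqE /=; lia.
set rhs := RHS; pose Q (p : cell) := (p.2 == y + 1) && (x < p.1).
transitivity (rhs (+) bd c Q); last by rewrite cyc addbF.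
rewrite /rhs /bd -big_split /Q /=.
apply: eq_bigr => -[[] [x' y']] _; rewrite /crossed /src /tgt /= !xpair_eqE /=; lia.
Qed.

Lemma crossing_cyclel c d : cycle c -> crossing c d = bd d (ray c).
Proof. by move=> cyc; apply: eq_bigr => e _; exact: ray_cycle. Qed.

Definition lower_ray c (p : cell) := ray c (p.1 - 1, p.2 - 1).

(** Moving [c] by (1/2, 1/2) amounts to moving [d] by (-1/2, -1/2), so the rays now start at p -
    (1/2, 1/2). *)
Lemma crossing_cycler c d : cycle c -> crossing d c = bd d (lower_ray c).
Proof.
move=> cyc; rewrite /crossing /bd.
under eq_bigr do rewrite /coef odd_count_big.
rewrite exchange_big; apply: eq_bigr => -[b [x y]] _.
(* [e] is the only edge that [crossed] sends to [(b, (x, y))]. *)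
pose e : edge := if b then vedge x (y - 1) else hedge (x - 1) y.
transitivity (coef c e).
  rewrite /coef odd_count_big; apply: eq_bigr => -[b' [x' y']] _.
  rewrite /e /crossed /tgt; clear e; case: b b' => -[] /=; rewrite !xpair_eqE /=; lia.
have := ray_cycle (if b then hedge (x - 1) (y - 1) else vedge (x - 1) (y - 1)) cyc.
rewrite /e /lower_ray /crossed /src /tgt; clear e; case: b => /=; rewrite ?subrK.
  by move=> ->; rewrite addrK.
by move=> ->; rewrite addrK.
Qed.

(* The part of [c] that separates p - (1/2, 1/2) from p + (1/2, 1/2). *)
Definition turn c (p : cell) : bool :=
  coef c (vedge p.1 (p.2 - 1)) (+) coef c (hedge p.1 p.2).

Lemma turn_cat c d p : turn (c ++ d) p = turn c p (+) turn d p.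
Proof.
by rewrite /turn !coef_cat -!addbA; congr addb; rewrite addbCA.
Qed.

Lemma turn_cycle c p : cycle c -> ray c p (+) lower_ray c p = turn c p.
Proof.
case: p => x y cyc; rewrite /turn /lower_ray /=.
have := ray_cycle (vedge x (y - 1)) cyc.
have := ray_cycle (hedge (x - 1) (y - 1)) cyc.
rewrite /crossed /src /tgt /= ?subrK => -> ->.
by case: (ray _ _) (ray _ _) (ray _ _) => -[] [].
Qed.

(** The two crossing numbers differ by the direction of the shift. As [c] is closed, this matters
    only at the ends of [d], where [turn] measures it. *)
Lemma crossing_cycleC c d p q : cycle c -> (forall Q, bd d Q = Q p (+) Q q) ->
  crossing c d (+) crossing d c = turn c p (+) turn c q.
Proof.
move=> cyc bdd; rewrite crossing_cyclel // crossing_cycler // !bdd.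
rewrite -!turn_cycle //.
by case: (ray c p) (ray c q) (lower_ray c p) (lower_ray c q) => -[] [] [].
Qed.

Lemma crossing_cycle2 c d : cycle c -> cycle d -> crossing c d = false.
Proof. by move=> cc cd; rewrite crossing_cyclel. Qed.

Definition supported (D : cell -> Prop) (c : seq edge) :=
  forall e, e \in c -> D (src e) /\ D (tgt e).

Lemma coef0 c e : e \notin c -> coef c e = false.
Proof. by move=> /count_memPn; rewrite /coef => ->. Qed.

Lemma crossing_disjoint D1 D2 c d : supported D1 c -> supported D2 d ->
  (forall p, D1 p -> D2 p -> False) -> crossing c d = false.
Proof.
move=> s1 s2 dis; rewrite /crossing big_seq big1 // => e /s2[_ De].
by apply: coef0; apply/negP => /s1[/dis + _]; apply.
Qed.

Lemma turn_avoid D c p : supported D c -> ~ D p -> turn c p = false.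
Proof.
case: p => x y sc Dp; rewrite /turn !coef0 //; apply/negP => /sc[D1 D2]; apply: Dp.
  exact: D1.
by move: D2; rewrite /tgt /= subrK.
Qed.

(** An up-then-right path. All hooks will start at one corner to the lower left of every target,
    which makes their crossing numbers explicit. *)
Definition hook (o t : cell) : seq edge :=
  [seq hedge (o.1 + k%:Z) t.2 | k <- iota 0 `|t.1 - o.1|%N] ++
  [seq vedge o.1 (o.2 + k%:Z) | k <- iota 0 `|t.2 - o.2|%N].

Lemma bd_hline x y n Q :
  bd [seq hedge (x + k%:Z) y | k <- iota 0 n] Q = Q (x, y) (+) Q (x + n%:Z, y).
Proof.
elim: n => [|n IH]; first by rewrite /bd big_nil addr0 addbb.
rewrite -addn1 iotaD map_cat bd_cat IH /= add0n /bd big_seq1 /src /tgt /=.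
rewrite PoszD addrA; by case: (Q _) (Q _) (Q _) => -[] [].
Qed.

Lemma bd_vline x y n Q :
  bd [seq vedge x (y + k%:Z) | k <- iota 0 n] Q = Q (x, y) (+) Q (x, y + n%:Z).
Proof.
elim: n => [|n IH]; first by rewrite /bd big_nil addr0 addbb.
rewrite -addn1 iotaD map_cat bd_cat IH /= add0n /bd big_seq1 /src /tgt /=.
rewrite PoszD addrA; by case: (Q _) (Q _) (Q _) => -[] [].
Qed.

Definition below (o t : cell) := (o.1 < t.1) && (o.2 < t.2).

Lemma bd_hook o t Q : below o t -> bd (hook o t) Q = Q o (+) Q t.
Proof.
case: o t => [ox oy] [x y] /andP[/= lx ly].
rewrite /hook bd_cat bd_hline bd_vline /=.
have -> : ox + (`|x - ox|%N)%:Z = x by lia.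
have -> : oy + (`|y - oy|%N)%:Z = y by lia.
by case: (Q _) (Q _) (Q _) => -[] [].
Qed.

Lemma coef_hook_h o t x y : below o t ->
  coef (hook o t) (hedge x y) = [&& y == t.2, o.1 <= x & x < t.1].
Proof.
case: o t => [ox oy] [tx ty] /andP[/= lx ly].
rewrite /hook coef_cat [X in _ (+) X]coef0 ?addbF; last by apply/mapP => -[].
rewrite /coef count_uniq_mem; last first.
  by rewrite map_inj_uniq ?iota_uniq // => i j []; lia.
rewrite oddb; apply/mapP/idP => [[k]|].
  by rewrite mem_iota /= => kl [-> ->]; lia.
move=> /= H; exists `|x - ox|%N; first by rewrite mem_iota; lia.
congr (_, (_, _)) => /=; lia.
Qed.

Lemma coef_hook_v o t x y : o.1 < x -> coef (hook o t) (vedge x y) = false.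
Proof.
move=> ox; apply: coef0; rewrite mem_cat negb_or; apply/andP; split.
  by apply/mapP => -[].
by apply/mapP => -[k _ [xo _]]; move: ox; rewrite xo ltxx.
Qed.

(** Only the vertical part of the moved second hook can meet the first hook; it meets the horizontal
    part exactly when it rises that high. *)
Lemma crossing_hook o t u : below o t -> below o u ->
  crossing (hook o t) (hook o u) = (t.2 <= u.2).
Proof.
move=> ot ou; rewrite {2}/hook crossing_catr.
rewrite {1}/crossing big_map big1 ?addFb; last first.
  by move=> k _; rewrite /crossed /tgt /= coef_hook_v //; case: (o) => ox oy /=; lia.
rewrite /crossing big_map.
under eq_bigr do rewrite /crossed /tgt /= coef_hook_h //.
case: o t u ot ou => [ox oy] [tx ty] [ux uy] /andP[/= ? ?] /andP[/= ? ?].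
have -> : (ty <= uy) = (`|ty - oy| <= `|uy - oy|)%N by lia.
elim: `|uy - oy|%N => [|n IH]; first by rewrite big_nil; lia.
rewrite -addn1 iotaD big_cat /= IH big_seq1; lia.
Qed.

(** At different heights exactly one of the crossing numbers is odd and there is no turn. At equal
    heights both are odd and cancel, but the nearer target lies on the other hook and yields one
    turn. *)
Lemma hook_pair o t u : below o t -> below o u -> t != u ->
  crossing (hook o t) (hook o u) (+) crossing (hook o u) (hook o t) (+)
  turn (hook o t) u (+) turn (hook o u) t = true.
Proof.
move=> ot ou tu; rewrite !crossing_hook // /turn !coef_hook_h //.
case: o t u ot ou tu => [ox oy] [tx ty] [ux uy].
rewrite /below xpair_eqE /= => /andP[? ?] /andP[? ?] ?.
by rewrite !coef_hook_v // !addFb; lia.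
Qed.

(** * Connectedness of sets of cells *)

Definition grid_adj (p q : cell) : Prop :=
  (`|p.1 - q.1| + `|p.2 - q.2| = 1)%R.

Lemma grid_adjC p q : grid_adj p q -> grid_adj q p.
Proof. by rewrite /grid_adj distrC [`|p.2 - _|]distrC. Qed.

Inductive joined (D : cell -> Prop) (p : cell) : cell -> Prop :=
| joined0 : D p -> joined D p p
| joinedS u v : joined D p u -> grid_adj u v -> D v -> joined D p v.

Lemma joined_chain D p q : joined D p q ->
  exists2 c, supported D c & forall Q, bd c Q = Q p (+) Q q.
Proof.
suff H : joined D p q -> D q /\
    exists2 c, supported D c & forall Q, bd c Q = Q p (+) Q q by case/H.
elim=> [Dp|u v _ [Du [c sc bc]] uv Dv]; split=> //.
  by exists [::] => // Q; rewrite /bd big_nil addbb.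
have [e [[se te]|[se te]]] : exists e, (src e = u /\ tgt e = v) \/
                                     (src e = v /\ tgt e = u).
  case: u v uv {bc Du Dv} => [x y] [x' y']; rewrite /grid_adj /= => uv.
  pose e : edge := (y == y', if (x <= x') && (y <= y') then (x, y) else (x', y')).
  exists e; rewrite /e /src /tgt /=; case: (y =P y') => ?; case: ifPn => ? /=;
    [left|right|left|right]; split=> //; congr (_, _); lia.
- exists (e :: c) => [e'|Q].
    by rewrite inE => /predU1P[->|/sc//]; rewrite se te.
  by rewrite /bd big_cons -/(bd c Q) bc se te; case: (Q u) (Q v) (Q p) => -[] [].
- exists (e :: c) => [e'|Q].
    by rewrite inE => /predU1P[->|/sc//]; rewrite se te.
  by rewrite /bd big_cons -/(bd c Q) bc se te; case: (Q u) (Q v) (Q p) => -[] [].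
Qed.

(* The parity of the number of crossings between independent edges of a drawing
   of K_{3,3} is odd.  Closing up each path s_i -- t_j by s_i -- t_0 and a hook
   turns the crossing numbers of independent paths into those of cycles, which
   vanish; the hooks alone contribute an odd defect. *)
Theorem K33_not_planar (s t : 'I_3 -> cell) (D : 'I_3 -> 'I_3 -> cell -> Prop) :
  (forall i j, joined (D i j) (s i) (t j)) ->
  (forall i j k l p, i != k -> j != l -> D i j p -> D k l p -> False) -> False.
Proof.
move=> st dis.
have [E sE bE] : exists2 E : 'I_3 -> 'I_3 -> seq edge,
    forall i j, supported (D i j) (E i j) &
    forall i j Q, bd (E i j) Q = Q (s i) (+) Q (t j).
  have /fin_all_exists2[E' E1 E2] (ij : 'I_3 * 'I_3) :
      exists2 c, supported (D ij.1 ij.2) c &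
        forall Q, bd c Q = Q (s ij.1) (+) Q (t ij.2).
    exact: joined_chain.
  by exists (fun i j => E' (i, j)) => i j; [apply: (E1 (i, j))|apply: (E2 (i, j))].
have Dt i j k l : i != k -> j != l -> ~ D i j (t l).
  move=> ik jl Dt; apply: (dis _ _ _ _ _ ik jl Dt).
  by have := st k l; elim.
have Et i j k l : i != k -> j != l -> turn (E i j) (t l) = false.
  by move=> ik jl; apply: turn_avoid (sE _ _) (Dt _ _ _ _ ik jl).
have X0 i j k l : i != k -> j != l -> crossing (E i j) (E k l) = false.
  by move=> ik jl; apply: crossing_disjoint (sE _ _) (sE _ _) _ => p; exact: dis.
pose i0 : 'I_3 := inord 0; pose i1 : 'I_3 := inord 1; pose i2 : 'I_3 := inord 2.
have [n01 n02 n12] : [/\ i0 != i1, i0 != i2 & i1 != i2].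
  by split; rewrite -val_eqE /= !inordK.
have [n10 n20 n21] : [/\ i1 != i0, i2 != i0 & i2 != i1].
  by rewrite eq_sym n01 eq_sym n02 eq_sym n12.
have t_inj j l : j != l -> t j != t l.
  move=> jl; apply/eqP => tjl; apply: (Dt i0 j i1 l) => //; rewrite -tjl.
  by have := st i0 j; elim.
have [c0 ot] : exists c0, forall j, below c0 (t j).
  exists (- \sum_j (`|(t j).1| + 1), - \sum_j (`|(t j).2| + 1)) => j.
  have le (F : 'I_3 -> int) : - \sum_j (`|F j| + 1) < F j.
    rewrite (bigD1 j) //= ltrNl; apply: (@lt_le_trans _ _ (`|F j| + 1)); first by lia.
    by rewrite lerDl; apply: sumr_ge0 => k _; lia.
  by apply/andP; split; exact: le.
pose H j := hook c0 (t j).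
pose n j := H j ++ H i0.
pose c i j := E i j ++ E i i0 ++ n j.
have bn j Q : bd (n j) Q = Q (t j) (+) Q (t i0).
  by rewrite /n bd_cat !bd_hook //; case: (Q c0) (Q (t j)) (Q (t i0)) => -[] [].
have cyc i j : cycle (c i j).
  by move=> Q; rewrite /c 2!bd_cat bn !bE;
     case: (Q (s i)) (Q (t j)) (Q (t i0)) => -[] [].
(* Once the crossings of independent paths are dropped, adding the eleven identities mod 2 cancels
   every remaining crossing and turn, while the three uses of [hook_pair] leave an odd total. *)
have e1 := crossing_cycle2 (cyc i0 i1) (cyc i1 i2).
have e2 := crossing_cycle2 (cyc i0 i2) (cyc i1 i1).
have e3 := crossing_cycle2 (cyc i0 i1) (cyc i2 i2).
have e4 := crossing_cycle2 (cyc i0 i2) (cyc i2 i1).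
have e5 := crossing_cycle2 (cyc i1 i1) (cyc i2 i2).
have e6 := crossing_cycle2 (cyc i1 i2) (cyc i2 i1).
have e7 := crossing_cycleC (cyc i1 i1) (bn i2).
have e8 := crossing_cycleC (cyc i1 i2) (bn i1).
have e9 := hook_pair (ot i0) (ot i1) (t_inj _ _ n01).
have e10 := hook_pair (ot i0) (ot i2) (t_inj _ _ n02).
have e11 := hook_pair (ot i1) (ot i2) (t_inj _ _ n12).
move: e1 e2 e3 e4 e5 e6 e7 e8 e9 e10 e11.
rewrite /c /n -!/(H _) !(crossing_catl, crossing_catr, turn_cat).
have X1 i k (ik : i != k) := (X0 i i1 k i2 ik n12, X0 i i2 k i1 ik n21,
  X0 i i1 k i0 ik n10, X0 i i2 k i0 ik n20, X0 i i0 k i1 ik n01,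
  X0 i i0 k i2 ik n02).
rewrite !(X1 _ _ n01) !(X1 _ _ n02) !(X1 _ _ n12).
have Et1 j l := Et i1 j i0 l n10.
rewrite !(Et1 _ _ n12) !(Et1 _ _ n21) !(Et1 _ _ n10) !(Et1 _ _ n20).
rewrite !(Et1 _ _ n01) !(Et1 _ _ n02).
have addbE a b : a (+) b = xorb a b by case: a b => -[].
rewrite !addbE.
repeat match goal with |- context [crossing ?a ?b] =>
  let v := fresh "v" in generalize (crossing a b); intro v end.
repeat match goal with |- context [turn ?a ?b] =>
  let v := fresh "v" in generalize (turn a b); intro v end.
move=> e1 e2 e3 e4 e5 e6 e7 e8 e9 e10 e11.
have X a b x y : a = b -> x = y -> xorb a x = xorb b y by move=> -> ->.
have := X _ _ _ _ e1 (X _ _ _ _ e2 (X _ _ _ _ e3 (X _ _ _ _ e4 (X _ _ _ _ e5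
  (X _ _ _ _ e6 (X _ _ _ _ e7 (X _ _ _ _ e8 (X _ _ _ _ e9
  (X _ _ _ _ e10 e11))))))))).
match goal with |- ?a = ?b -> _ =>
  have -> : a = negb b by clear; btauto end.
by case: (X in ~~ X).
Qed.

(** * Layerings of families of connected cell sets *)

Local Open Scope classical_set_scope.
Local Open Scope nat_scope.

Definition apart (A B : set cell) := forall p, A p -> B p -> False.

Lemma K33_not_planar_explicit (s0 s1 s2 t0 t1 t2 : cell)
    (D00 D01 D02 D10 D11 D12 D20 D21 D22 : set cell) :
  joined D00 s0 t0 -> joined D01 s0 t1 -> joined D02 s0 t2 ->
  joined D10 s1 t0 -> joined D11 s1 t1 -> joined D12 s1 t2 ->
  joined D20 s2 t0 -> joined D21 s2 t1 -> joined D22 s2 t2 ->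
  apart D00 D11 -> apart D00 D12 -> apart D00 D21 -> apart D00 D22 ->
  apart D01 D10 -> apart D01 D12 -> apart D01 D20 -> apart D01 D22 ->
  apart D02 D10 -> apart D02 D11 -> apart D02 D20 -> apart D02 D21 ->
  apart D10 D21 -> apart D10 D22 -> apart D11 D20 -> apart D11 D22 ->
  apart D12 D20 -> apart D12 D21 -> False.
Proof.
move=> j00 j01 j02 j10 j11 j12 j20 j21 j22.
move=> a0011 a0012 a0021 a0022 a0110 a0112 a0120 a0122 a0210 a0211 a0220 a0221.
move=> a1021 a1022 a1120 a1122 a1220 a1221.
pose s (i : 'I_3) := nth s0 [:: s0; s1; s2] i.
pose t (i : 'I_3) := nth t0 [:: t0; t1; t2] i.
pose D (i j : 'I_3) := nth set0 (nth [::] [:: [:: D00; D01; D02];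
  [:: D10; D11; D12]; [:: D20; D21; D22]] i) j.
apply: (@K33_not_planar s t D).
  by move=> [[|[|[|]]]] // ? [[|[|[|]]]] // ?; rewrite /s /t /D.
have H (i j k l : 'I_3) : i < k -> j != l -> apart (D i j) (D k l).
  by case: i k j l => [[|[|[|]]]] // ? [[|[|[|]]]] // ? [[|[|[|]]]] // ?
     [[|[|[|]]]] // ? _ _; rewrite /D.
move=> i j k l p; rewrite -val_eqE neq_ltn => /orP[ik|ki] jl Dij Dkl.
  exact: (H _ _ _ _ ik jl p).
by apply: (H _ _ _ _ ki _ p) Dkl Dij; rewrite eq_sym.
Qed.

Lemma joined_l D p q : joined D p q -> D p.
Proof. by elim. Qed.

Lemma joined_r D p q : joined D p q -> D q.
Proof. by case. Qed.

Lemma joined_trans D q p r : joined D p q -> joined D q r -> joined D p r.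
Proof. by move=> pq; elim=> // u v _ pu uv Dv; apply: joinedS pu uv Dv. Qed.

Lemma joined_sym D p q : joined D p q -> joined D q p.
Proof.
elim=> [Dp|u v pu IH uv Dv]; first exact: joined0.
apply: joined_trans IH; apply: joinedS (joined0 Dv) (grid_adjC uv) _.
exact: joined_r pu.
Qed.

Lemma joined_sub (D D' : set cell) p q : D `<=` D' -> joined D p q -> joined D' p q.
Proof.
move=> sD; elim=> [/sD|u v _ pu uv /sD]; first exact: joined0.
exact: joinedS pu uv.
Qed.

Lemma joined_component D p q : joined D p q -> joined (joined D p) p q.
Proof.
elim=> [Dp|u v pu IH uv Dv]; first by do 2 apply: joined0.
by apply: (joinedS IH uv); apply: (joinedS pu uv).
Qed.

Definition connected4 (s : set cell) := forall p q, s p -> s q -> joined s p q.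

Lemma connected4_component D p : connected4 (joined D p).
Proof.
move=> u v pu pv; apply: joined_trans (joined_component pv).
exact/joined_sym/joined_component.
Qed.

(** * Distance in the intersection pattern of a family *)

Definition link (F : set (set cell)) p q := exists2 s, F s & s p /\ s q.

Fixpoint reach F n p q : Prop :=
  if n is m.+1 then p = q \/ exists2 u, reach F m p u & link F u q else p = q.

Arguments reach : simpl never.

Lemma linkC F p q : link F p q -> link F q p.
Proof. by case=> s Fs [sp sq]; exists s. Qed.

Lemma reach_refl F n p : reach F n p p.
Proof. by case: n => //= n; left. Qed.

Lemma reachS F n p q : reach F n p q -> reach F n.+1 p q.
Proof.
elim: n q => [q|n IH q]; first by left.
by case=> [->|[u /IH pu uq]]; [left|right; exists u].
Qed.

Lemma reach_le F m n p q : m <= n -> reach F m p q -> reach F n p q.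
Proof. by move=> /subnK<-; elim: (n - m) => // k IH /IH; exact: reachS. Qed.

Lemma reach_trans F m n p q r : reach F m p q -> reach F n q r -> reach F (m + n) p r.
Proof.
move=> pq; elim: n r => [r <-|n IH r]; first by rewrite addn0.
case=> [<-|[u qu ur]]; first by apply: reach_le pq; lia.
by rewrite addnS; right; exists u => //; exact: IH.
Qed.

Lemma link_reach F p q : link F p q -> reach F 1 p q.
Proof. by right; exists p. Qed.

Lemma reach_sym F n p q : reach F n p q -> reach F n q p.
Proof.
elim: n q => [//|n IH q [->|[u /IH up /linkC/link_reach qu]]]; first by left.
by rewrite -add1n; apply: reach_trans qu up.
Qed.

Lemma reach_sub F F' n p q : (forall u v, link F u v -> link F' u v) ->
  reach F n p q -> reach F' n p q.
Proof.
move=> FF'; elim: n q => [//|n IH q [->|[u /IH pu /FF' uq]]]; first by left.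
by right; exists u.
Qed.

Lemma reach_within F A n p q : (forall s, F s -> s `<=` A) -> A p ->
  reach F n p q -> A q.
Proof.
by move=> FA Ap; elim: n q => [_ <-|n IH q [<-|[u _ [s /FA sA [_ /sA]]]]].
Qed.

Definition frag (F : set (set cell)) (A : set cell) : set (set cell) :=
  [set t | [/\ connected4 t, t `<=` A & exists2 s, F s & t `<=` s]].

Lemma frag_link F A s p q : F s -> joined (s `&` A) p q -> link (frag F A) p q.
Proof.
move=> Fs pq; exists (joined (s `&` A) p); last first.
  by split=> //; apply: joined0; exact: joined_l pq.
split; first exact: connected4_component.
  by move=> u /joined_r[].
by exists s => // u /joined_r[].
Qed.

Lemma link_frag F A p q : link (frag F A) p q -> link F p q.
Proof. by case=> t [_ _ [s Fs ts]] [/ts sp /ts sq]; exists s. Qed.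

(** These axioms abstract the distance to a root chosen in each component; the last one makes
    descents from connected cells end at the same root. *)
Definition layering (F : set (set cell)) (f : cell -> nat) :=
  [/\ forall p q, link F p q -> f q <= (f p).+1,
      forall p, 0 < f p -> exists2 q, link F p q & (f q).+1 = f p &
      forall n p q, reach F n p q -> f p = 0 -> f q = 0 -> p = q].

Lemma exists_layering F : exists f, layering F f.
Proof.
pose conn p q := exists n, reach F n p q.
have conn_refl p : conn p p by exists 0.
have conn_sym p q : conn p q -> conn q p by case=> n /reach_sym; exists n.
have conn_trans q p r : conn p q -> conn q r -> conn p r.
  by move=> [m pq] [n qr]; exists (m + n); exact: reach_trans pq qr.
(* The chosen root depends only on the component, since connected cells have equal sets [conn p]. *)
pose rt p := xget (0%R, 0%R) (conn p).
have rtP p : conn p (rt p) by rewrite /rt; apply: xgetPex; exists p.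
have rt_eq p q : conn p q -> rt p = rt q.
  move=> pq; rewrite /rt (_ : conn p = conn q) //; apply/funext => r.
  by apply/propext; split; [move/conn_sym: pq|move: pq]; exact: conn_trans.
have ex p : exists n, `[< reach F n (rt p) p >].
  by have [n /reach_sym pn] := rtP p; exists n; apply/asboolP.
pose f p := ex_minn (ex p).
have fP p : reach F (f p) (rt p) p by rewrite /f; case: ex_minnP => n /asboolP.
have f_min n p : reach F n (rt p) p -> f p <= n.
  by move=> pn; rewrite /f; case: ex_minnP => m _; apply; apply/asboolP.
exists f; split.
- move=> p q pq; apply: f_min; rewrite -(rt_eq p q); last first.
    by exists 1; exact: link_reach.
  by right; exists p.
- move=> p; have := fP p; case E: (f p) => [//|k] [rp|[q rq qp]] _.
    by have := f_min 0 p rp; rewrite E.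
  have rpq : rt p = rt q by apply: rt_eq; exists 1; apply/link_reach/linkC.
  exists q; first exact: linkC.
  congr S; apply/eqP; rewrite eqn_leq; apply/andP; split.
    by apply: f_min; rewrite -rpq.
  have : reach F (f q).+1 (rt p) p by right; exists q => //; rewrite rpq.
  by move/f_min; rewrite E.
- move=> n p q pq fp fq.
  have := fP p; have := fP q; rewrite fp fq /= => <- <-.
  by apply: rt_eq; exists n.
Qed.

Lemma reach_layering F f n p q : layering F f -> reach F n p q -> f q <= f p + n.
Proof.
move=> [f1 _ _]; elim: n q => [q <-|n IH q [<-|[u /IH pu /f1]]]; lia.
Qed.

Lemma joined_exit D (P : set cell) p q : joined D p q -> ~ P p -> P q ->
  exists e e', [/\ joined (D `&` ~` P) p e, grid_adj e e', D e' & P e'].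
Proof.
move=> pq Pp; suff H : joined (D `&` ~` P) p q \/
    exists e e', [/\ joined (D `&` ~` P) p e, grid_adj e e', D e' & P e'].
  by move=> Pq; case: H => [/joined_r[]|].
elim: pq => [Dp|u v _ [IH|IH] uv Dv]; [by left; apply: joined0| |by right].
have [Pv|Pv] := pselect (P v); last by left; apply: joinedS IH uv _.
by right; exists u, v.
Qed.

(* A steepest descent from [p] to a root, as a set [D] of cells: the part of the
   descent before (resp. after) a cell [u] stays above (resp. below) level [f u].
   Before it leaves a union [A] of levels, it moves along pieces of members of
   [F] cut by [A], at most one per level. *)
Lemma descent F f p : (forall s, F s -> connected4 s) -> layering F f ->
  exists (D : set cell) (q0 : cell),
  [/\ f q0 = 0 /\ D p, forall u, D u -> f u <= f p,
      forall u, D u -> joined (D `&` [set v | f u <= f v]) p u /\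
                      joined (D `&` [set v | f v <= f u]) u q0,
      forall j, j <= f p -> exists2 u, D u & f u = j &
      forall u A, D u -> (forall v, f u <= f v <= f p -> A v) ->
        reach (frag F A) (f p - f u).+1 p u].
Proof.
move=> Fc lf; have [f1 f2 _] := lf.
elim: {p}(f p) {-2}p (erefl (f p)) => [|k IH] p fp.
  exists [set p], p; split=> //.
  - by move=> u ->.
  - by move=> u ->; split; apply: joined0; split=> /=.
  - by move=> j; rewrite fp leqn0 => /eqP->; exists p.
  - by move=> u A -> _; exact: reach_refl.
have [q [s Fs [sp sq]] fq] : exists2 q, link F p q & (f q).+1 = f p.
  by apply: f2; rewrite fp.
(* [s] meets the levels k and k + 1, so the Lipschitz property confines it to them. *)
have sk u : s u -> k <= f u <= k.+1.
  move=> su; have := f1 u p; have := f1 q u; rewrite fp.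
  have <- : f q = k by lia.
  by move=> H1 H2; apply/andP; split; [rewrite -ltnS; apply: H2|apply: H1]; exists s.
have [e [e' [pe ee' se' fe']]] := joined_exit (P := [set v | f v = k])
  (Fc s Fs p q sp sq) ltac:(by rewrite /= fp; lia) ltac:(by rewrite /=; lia).
rewrite /= in fe'; pose L := s `&` ~` [set v | f v = k].
have fL u : L u -> f u = k.+1 by move=> [/sk + /=]; lia.
have [D [q0 [[fo De'] Dle Dj Dex Dn]]] := IH e' fe'.
(* The descent from [p] is this piece of [s] at level k + 1, followed by a descent from [e'], the
   first cell of [s] met at level k. *)
pose C := joined L p.
have fC u : C u -> f u = k.+1 by move/joined_r/fL.
have pC : C p by apply: joined0; exact: joined_l pe.
have pe' : joined (s `&` [set v | k <= f v <= k.+1]) p e'.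
  apply: joinedS ee' _; last by split=> //=; exact: sk.
  by apply: joined_sub pe => u Lu; split; [case: Lu|apply: sk; case: Lu].
have down : joined ((C `|` D) `&` [set v | f v <= k.+1]) p q0.
  apply: (@joined_trans _ e').
    apply: joinedS ee' _; last by split=> /=; [right|lia].
    apply: joined_sub (joined_component pe) => u Cu; split; first by left.
    by rewrite /= fC.
  apply: joined_sub (Dj e' De').2 => u [Du]; rewrite /= fe' => fu.
  by split=> /=; [right|lia].
exists (C `|` D), q0; split.
- by split=> //; left.
- by move=> u [/fC->|/Dle]; lia.
- move=> u [Cu|Du]; split.
  + apply: joined_sub (joined_component Cu) => v Cv; split; first by left.
    by rewrite /= (fC u) // (fC v).
  + rewrite fC //; apply: joined_trans down; apply: joined_sym.
    apply: joined_sub (joined_component Cu) => v Cv; split; first by left.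
    by rewrite /= (fC v).
  + have := Dle u Du; rewrite fe' => fu; apply: (@joined_trans _ e').
      apply: joinedS ee' _; last by split=> /=; [right|lia].
      apply: joined_sub (joined_component pe) => v Cv; split; first by left.
      by rewrite /= (fC v) //; lia.
    by apply: joined_sub (Dj u Du).1 => v [Dv fv]; split=> //; right.
  + by apply: joined_sub (Dj u Du).2 => v [Dv fv]; split=> //; right.
- move=> j; rewrite leq_eqVlt => /orP[/eqP->|jk]; first by exists p => //; left.
  by have [|u Du fu] := Dex j; [lia|exists u => //; right].
- move=> u A [Cu|Du] Au.
    have fu := fC u Cu; rewrite fu fp subnn; apply: link_reach; apply: (frag_link Fs).
    apply: joined_sub Cu => v Lv; split; first by case: Lv.
    by apply: Au; rewrite (fL v Lv) fu fp !leqnn.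
  have fu := Dle u Du; rewrite fe' in fu.
  have -> : (f p - f u).+1 = 1 + (k - f u).+1 by lia.
  apply: (@reach_trans _ _ _ _ e').
    apply: link_reach; apply: (frag_link Fs).
    by apply: joined_sub pe' => v [sv /= fv]; split=> //; apply: Au; lia.
  by rewrite -[k in k - f u]fe'; apply: Dn => // v fv; apply: Au; lia.
Qed.

Inductive chain (T : Type) (e : T -> T -> Prop) (p : T) : T -> Prop :=
| chain0 : chain e p p
| chainS u v : chain e p u -> e u v -> chain e p v.

Lemma reach_le_trans F k m n p q r : reach F m p q -> reach F n q r -> m + n <= k ->
  reach F k p r.
Proof. by move=> pq qr mn; apply: reach_le mn _; exact: reach_trans qr. Qed.

(* If the walk had far ends x and y, it would contain a cell z far from both.
   Let v be a cell on a steepest g-descent from z, well below level alpha.  The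
   steepest descents with respect to f and g from x, y and v, together with the
   walk, then draw K_{3,3} with parts {x, y, v} and {root of f, root of g, z}. *)
Lemma walk_bounded F f g a b alpha beta w x y :
  (forall s, F s -> connected4 s) -> layering F f ->
  let A := [set p | a <= f p <= b] in
  let Z := A `&` [set p | alpha <= g p <= beta] in
  layering (frag F A) g -> b <= a + w -> beta <= alpha + w -> Z x ->
  chain (fun u v => [/\ grid_adj u v, link (frag F A) u v & Z v]) x y ->
  reach F (12 * w + 18) x y.
Proof.
move=> Fc lf A Z lg ba bw Zx xy; apply: contrapT => far.
pose nA := reach (frag F A).
have nAF n p q : nA n p q -> reach F n p q.
  by apply: reach_sub => u v; exact: link_frag.
have FAc s : frag F A s -> connected4 s by case.
have FAA s : frag F A s -> s `<=` A by case.
have gl n p q : nA n p q -> g q <= g p + n by exact: reach_layering.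
have far' m n u : m + n <= 12 * w + 18 -> reach F m x u -> reach F n y u -> False.
  by move=> mn xu yu; case: far; apply: reach_le_trans xu (reach_sym yu) mn.
have desc1 p : A p -> exists (D : set cell) (q0 : cell),
    [/\ g q0 = 0 /\ D p, nA (g p).+1 p q0,
        forall u, D u -> [/\ A u, g u <= g p & nA (g p - g u).+1 p u],
        forall u, D u -> joined (D `&` [set v | g u <= g v]) p u /\
                        joined (D `&` [set v | g v <= g u]) u q0 &
        forall j, j <= g p -> exists2 u, D u & g u = j].
  move=> Ap; have [D [q0 [[go Dp] Dle Dj Dex Dn]]] := descent p FAc lg.
  have reach_D u : D u -> nA (g p - g u).+1 p u.
    move=> Du; have := Dn u setT Du (fun _ _ => I).
    by apply: reach_sub => ? ? /link_frag.
  exists D, q0; split=> //.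
    have Do : D q0 by have [_ /joined_r[]] := Dj p Dp.
    by have := reach_D q0 Do; rewrite go subn0.
  move=> u Du; split; [|exact: Dle|exact: reach_D].
  by apply: reach_within (reach_D u Du); [exact: FAA|].
have desc0 p : A p -> exists (K : set cell) (q0 : cell),
    [/\ f q0 = 0, reach F (f p).+1 p q0, K p,
        forall u, K u -> A u /\ nA w.+1 p u &
        forall u, K u -> joined (K `|` [set v | f v < a]) u q0 /\ joined K p u].
  move=> Ap; have [D [q0 [[fo Dp] Dle Dj _ Dn]]] := descent p Fc lf.
  have /andP[ap pb] := Ap.
  have KB u : D u -> (D `&` [set v | a <= f v] `|` [set v | f v < a]) u.
    by move=> Du; have [?|?] := leqP a (f u); [left|right].
  exists (D `&` [set v | a <= f v]), q0; split=> //.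
  - have Do : D q0 by have [_ /joined_r[]] := Dj p Dp.
    have := Dn q0 setT Do (fun _ _ => I); rewrite fo subn0.
    by apply: reach_sub => ? ? /link_frag.
  - move=> u [Du /= au]; have pu := Dle u Du.
    split; first by rewrite /A /=; lia.
    apply: (reach_le _ (Dn u A Du _)); first by lia.
    by move=> v /andP[? ?]; rewrite /A /=; lia.
  - move=> u [Du /= au]; split.
      by apply: joined_sub (Dj u Du).2 => v [/KB].
    by apply: joined_sub (Dj u Du).1 => v [Dv /= fv]; split=> //=; lia.
(* [K] will stand for the vertex x or y of K_{3,3}: it is the part of the f-descent at levels f >= a
   together with the part of the g-descent at levels g >= alpha. The rest of the descents gives the
   arms to the two roots. *)
have tripod p : Z p -> exists (K X : set cell) (q0 q0' : cell),
   [/\ [/\ f q0 = 0, reach F (f p).+1 p q0, g q0' = 0 & nA (g p).+1 p q0'], K p,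
      forall u, K u -> A u /\ nA w.+1 p u,
      forall u, X u -> [/\ A u, g u <= g p & nA (g p - g u).+1 p u] &
      forall u, K u -> joined (K `|` [set v | f v < a]) u q0 /\
         joined (K `|` X `&` [set v | g v < alpha]) u q0'].
  move=> [Ap /= gp]; have [K [q0 [fo po Kp KA Kj]]] := desc0 p Ap.
  have [X [q0' [[go Xp] po' XA Xj _]]] := desc1 p Ap.
  pose X' := X `&` [set v | alpha <= g v].
  have XX u : X u -> (K `|` X' `|` X `&` [set v | g v < alpha]) u.
    by move=> Xu; have [?|?] := leqP alpha (g u); [left; right|right].
  have jX u : X' u -> joined X' p u.
    move=> [Xu /= au]; apply: joined_sub (Xj u Xu).1 => v [Xv /= gv].
    by split=> //=; lia.
  have X'p : X' p by split=> //=; lia.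
  exists (K `|` X'), X, q0, q0'; split=> //.
  - by left.
  - move=> u [/KA//|[Xu /= au]]; have [Au gu pu] := XA u Xu; split=> //.
    by apply: reach_le pu; lia.
  - have K0 : joined (K `|` X' `|` [set v | f v < a]) p q0.
      by apply: joined_sub (Kj p Kp).1 => v [|]; [left; left|right].
    have K1 : joined (K `|` X' `|` X `&` [set v | g v < alpha]) p q0'.
      by apply: joined_sub (Xj p Xp).2 => v [/XX].
    move=> u Ku; have up : joined (K `|` X') u p.
      apply: joined_sym; case: Ku => [/Kj[_]|/jX].
        by apply: joined_sub => v; left.
      by apply: joined_sub => v; right.
    by split; [apply: joined_trans K0|apply: joined_trans K1];
      apply: joined_sub up => v; left.
have [K [X1 [ox [oa [[fox xox goa xoa] Kx KA XA Kj]]]]] := tripod x Zx.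
(* Staying in the component of [x] in the annulus makes all descents end at the same two roots. *)
pose Z' := Z `&` [set u | exists n, nA n x u].
have Z'x : Z' x by split=> //; exists 0.
have xy' : chain (fun u v => [/\ grid_adj u v, link (frag F A) u v & Z' v]) x y /\
    Z' y.
  elim: xy => [|u v _ [IH [_ [n xu]]] [uv luv Zv]]; first by split=> //; exact: chain0.
  have Z'v : Z' v.
    by split=> //; exists (n + 1); apply: reach_trans xu _; exact: link_reach.
  by split=> //; apply: chainS IH _.
case: xy' => {}xy [Zy [nxy xyA]].
have [L [Y1 [oy [ob [[foy yoy gob yob] Ly LA YA Lj]]]]] := tripod y Zy.
have eo : ox = oy.
  apply: (let: And3 _ _ H := lf in H) fox foy.
  by apply: reach_trans (reach_trans (reach_sym xox) (nAF _ _ _ xyA)) yoy.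
have eb : oa = ob.
  apply: (let: And3 _ _ H := lg in H) goa gob.
  exact: reach_trans (reach_trans (reach_sym xoa) xyA) yob.
subst oy ob.
have [_ /andP[/= xg1 xg2]] := Zx; have [_ /andP[/= yg1 yg2]] := Zy.
(* An f-descent inside the annulus has length at most w + 1, so [h] keeps [M], which starts at level
   alpha - h, below alpha, and [K] and [L] above the level of [v]. [R] adds the distance 3w + 4 from
   [z] to [M] and the length, up to 3w + 4, of a g-descent from [x] or [y] to the levels of [M]; and
   2R + 1 is less than 12w + 18. *)
pose h := w + 2; pose R := 6 * w + 8.
(* If alpha is small, [x] and [y] are both close to the common root of g. *)
have [ah|ah] := ltnP alpha h.
  apply: (far' (g x).+1 (g y).+1 oa); [|exact: nAF|exact: nAF].
  by rewrite /h in ah; lia.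
have KL u : K u -> L u -> False.
  move=> /KA[_ xu] /LA[_ yu]; apply: (far' w.+1 w.+1 u); [lia|exact: nAF|exact: nAF].
(* The walk is followed until it first enters [L], at [y']. After its last visit [x'] to [K] it
   leaves the ball of radius [R] around [x], at [z]. The states [st1] and [st2] are those before and
   after [z]; a return to [K] resets to [st1]. *)
have [x' [y' [z [[Kx' Ly'] x'z zy' xz nxz]]]] : exists x' y' z,
    [/\ K x' /\ L y', joined (Z' `&` ~` L) x' z, joined (Z' `&` ~` K) z y',
        reach F R.+1 x z & ~ reach F R x z].
  have KR u : K u -> reach F R x u.
    by move=> /KA[_ /nAF]; apply: reach_le; rewrite /R; lia.
  pose st1 u := exists2 x', K x' & joined (Z' `&` ~` L) x' u /\ reach F R x u.
  pose st2 u := exists x' z, [/\ K x', joined (Z' `&` ~` L) x' z,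
    joined (Z' `&` ~` K) z u, reach F R.+1 x z & ~ reach F R x z].
  apply: contrapT => none.
  suff [nLy _] : ~ L y /\ (st1 y \/ st2 y) by exact: nLy.
  elim: xy => [|u v _ [nLu IH] [uv luv Z'v]].
    split; first exact: KL.
    left; exists x => //; split; last exact: reach_refl.
    by apply: joined0; split=> // /(KL _ Kx).
  have [Lv|nLv] := pselect (L v).
    exfalso; case: IH => [[x' Kx' [_ xu]]|[x' [z [Kx' x'z zu xz nxz]]]].
      apply: (far' R.+1 w.+1 v); first by rewrite /R; lia.
        by right; exists u => //; exact: link_frag luv.
      by apply: nAF; case: (LA v Lv).
    apply: none; exists x', v, z; split=> //.
    by apply: joinedS zu uv _; split=> // Kv; exact: KL Lv.
  split=> //; have [Kv|nKv] := pselect (K v).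
    left; exists v => //; split; last exact: KR.
    by apply: joined0; split.
  case: IH => [[x' Kx' [x'u xu]]|[x' [z [Kx' x'z zu xz nxz]]]].
    have x'v : joined (Z' `&` ~` L) x' v by apply: joinedS x'u uv _; split.
    have [xv|nxv] := pselect (reach F R x v); first by left; exists x'.
    right; exists x', v; split=> //; first by apply: joined0; split.
    by right; exists u => //; exact: link_frag luv.
  by right; exists x', z; split=> //; apply: joinedS zu uv _; split.
have nyz : ~ reach F R y z.
  by move=> yz; apply: (far' R.+1 R z) => //; rewrite /R; lia.
have [[Zz [nz xzA]] _] := joined_r x'z.
have [Az /andP[/= zg1 zg2]] := Zz.
have [W [oc [[goc Wz] zoc WA Wj Wex]]] := desc1 z Az.
have [v Wv gv] : exists2 v, W v & g v = alpha - h by apply: Wex; lia.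
have [Av _ zv] := WA v Wv.
have [M [od [fod vod Mv MA Mj]]] := desc0 v Av.
have ec : oa = oc.
  apply: (let: And3 _ _ H := lg in H) goa goc.
  exact: reach_trans (reach_trans (reach_sym xoa) xzA) zoc.
have ed : ox = od.
  apply: (let: And3 _ _ H := lf in H) fox fod.
  apply: reach_trans (reach_trans (reach_sym xox) (nAF _ _ _ xzA)) _.
  exact: reach_trans (nAF _ _ _ zv) vod.
subst oc od.
have Mz u : M u -> [/\ A u, reach F (3 * w + 4) z u, g u < alpha &
    alpha <= g u + h + w.+1].
  move=> /MA[Au vu]; split=> //.
  - by apply: reach_le_trans (nAF _ _ _ zv) (nAF _ _ _ vu) _; rewrite gv /h; lia.
  - by have := gl _ _ _ vu; rewrite gv /h; rewrite /h in ah; lia.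
  - by have := gl _ _ _ (reach_sym vu); rewrite gv; lia.
have AB u : A u -> f u < a -> False by move=> /andP[/= au _]; lia.
have Z'P u : Z' u -> A u /\ alpha <= g u by move=> [[Au /andP[]]].
(* [W2] joins [v] to [z] along the upper part of the g-descent; [W1] joins [v] to the root of g. *)
pose W1 := W `&` [set u | g u <= g v]; pose W2 := W `&` [set u | g v <= g u].
have W1P u : W1 u -> A u /\ g u + h <= alpha.
  by move=> [/WA[Au _ _]]; rewrite /= gv => gu; split=> //; lia.
have W2P u : W2 u -> [/\ A u, reach F (2 * w + 3) z u & alpha <= g u + h].
  move=> [/WA[Au _ zu]]; rewrite /= gv => gu; split=> //; last by lia.
  by apply: reach_le (nAF _ _ _ zu); rewrite /h in gu; lia.
(* Separates the arms of one end of the walk from the walk itself and from the arms of [v], for [x]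
   and [y] at once. *)
have arm p (Kp Xp : set cell) : Z p -> ~ reach F R p z ->
    (forall u, Kp u -> A u /\ nA w.+1 p u) ->
    (forall u, Xp u -> [/\ A u, g u <= g p & nA (g p - g u).+1 p u]) ->
    let E0 := Kp `|` [set v | f v < a] in
    let E1 := Kp `|` Xp `&` [set v | g v < alpha] in
    [/\ apart E0 (Z' `&` ~` Kp) /\ apart E1 (Z' `&` ~` Kp),
        apart E0 W1, apart E0 W2, apart E1 (M `|` [set v | f v < a]) & apart E1 W2].
  move=> [Ap /andP[/= gp1 gp2]] npz KpA XpA.
  have Kg u : Kp u -> alpha <= g u + w.+1.
    by move=> /KpA[_ /reach_sym/gl]; lia.
  have pz m n u : m + n <= R -> nA m p u -> reach F n z u -> False.
    by move=> mn /nAF pu zu; apply: npz; apply: reach_le_trans pu (reach_sym zu) mn.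
  split; first split.
  - by move=> u [Ku|Bu] [/Z'P[Au _] nK]; [exact: nK|exact: (AB u)].
  - by move=> u [Ku|[_ /= gu]] [/Z'P[Au ?] nK]; [exact: nK|lia].
  - by move=> u [/Kg gu|Bu] /W1P[Au]; [rewrite /h; lia|move=> _; exact: (AB u)].
  - move=> u [/KpA[_ pu]|Bu] /W2P[Au zu _]; last exact: (AB u).
    by apply: pz pu zu; rewrite /R; lia.
  - move=> u [/KpA[Au pu]|[/XpA[Au gu pu] _]] [/Mz[_ zu gu1 gu2]|/(AB _ Au)//].
      by apply: pz pu zu; rewrite /R; lia.
    by apply: pz pu zu; rewrite /R; rewrite /h in gu2; lia.
  - move=> u [/KpA[Au pu]|[/XpA[Au gu pu] _]] /W2P[_ zu gu2].
      by apply: pz pu zu; rewrite /R; lia.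
    by apply: pz pu zu; rewrite /R; rewrite /h in gu2; lia.
have cross p q (Kp Kq Xq : set cell) : Z p -> Z q ->
    (forall m n u, m + n <= 12 * w + 18 -> reach F m p u -> reach F n q u -> False) ->
    (forall u, Kp u -> A u /\ nA w.+1 p u) ->
    (forall u, Kq u -> A u /\ nA w.+1 q u) ->
    (forall u, Xq u -> [/\ A u, g u <= g q & nA (g q - g u).+1 q u]) ->
    apart (Kp `|` [set v | f v < a]) (Kq `|` Xq `&` [set v | g v < alpha]).
  move=> [_ /andP[/= gp1 gp2]] [_ /andP[/= gq1 gq2]] pq KpA KqA XqA u.
  have E1A : (Kq `|` Xq `&` [set v | g v < alpha]) u -> A u.
    by case=> [/KqA[]|[/XqA[]]].
  move=> [/KpA[_ pu]|Bu] qu; last by case: (AB u) => //; exact: E1A.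
  case: qu => [/KqA[_ qu]|[/XqA[_ gu qu] _]].
    by apply: pq (nAF _ _ _ pu) (nAF _ _ _ qu); lia.
  have := gl _ _ _ (reach_sym pu).
  by move=> gu'; apply: pq (nAF _ _ _ pu) (nAF _ _ _ qu); lia.
have walk0 u : Z' u -> (M `|` [set v | f v < a]) u -> False.
  by move=> /Z'P[Au gu] [/Mz[_ _ gu1 _]|/(AB _ Au)//]; lia.
have walk1 u : Z' u -> W1 u -> False.
  by move=> /Z'P[Au gu] /W1P[_]; rewrite /h; lia.
have [[x1 x2] x3 x4 x5 x6] := arm x K X1 Zx nxz KA XA.
have [[y1 y2] y3 y4 y5 y6] := arm y L Y1 Zy nyz LA YA.
(* Arms may overlap below level a on the way to the root of f, or at low levels of g on the way to
   its root: such arms share an end. *)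
apply: (K33_not_planar_explicit (Kj x' Kx').1 (Kj x' Kx').2 x'z
  (Lj y' Ly').1 (Lj y' Ly').2 (joined_sym zy') (Mj v Mv).1 (Wj v Wv).2
  (joined_sym (Wj v Wv).1)) => //.
- by apply: (cross x y) => // m n u; exact: far'.
- move=> u Ku Lu; apply: (cross y x) Lu Ku => // m n u' mn yu xu.
  by apply: (far' n m u') => //; rewrite addnC.
- by move=> u [Zu Lu] E0; exact: (y1 u).
- by move=> u [Zu Lu] E0; exact: (y2 u).
- by move=> u [/walk0].
- by move=> u [/walk1].
- by move=> u [/walk0].
- by move=> u [/walk1].
Qed.

(** * Colourings *)

Lemma chain_trans (T : Type) (e : T -> T -> Prop) q p r :
  chain e p q -> chain e q r -> chain e p r.
Proof. by move=> pq; elim=> // u v _; exact: chainS. Qed.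

Lemma chain_sym (T : Type) (e : T -> T -> Prop) p q :
  (forall u v, e u v -> e v u) -> chain e p q -> chain e q p.
Proof.
move=> se; elim=> [|u v _ IH /se vu]; first exact: chain0.
by apply: chain_trans IH; apply: chainS (chain0 _ _) vu.
Qed.

Definition band (f : cell -> nat) m r : set cell := [set p | m <= f p < m + r].

(** Cells are coloured by the parity of g at scale rho, where g layers the annulus that widens the
    band by rho on each side. Monochromatic chains then fill in to walks in windows of width at most
    3 rho for both f and g. *)
Lemma band_coloring F f m r rho :
  (forall s, F s -> connected4 s) -> layering F f -> 0 < rho -> r <= rho ->
  exists kappa : cell -> bool, forall p q,
    chain (fun u v => [/\ band f m r u, band f m r v, kappa u = kappa v &
                         reach F rho u v]) p q ->
    reach F (54 * rho) p q.
Proof.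
move=> Fc lf rho0 r_rho.
pose a := m - rho; pose b := m + r + rho.
pose A := [set p | a <= f p <= b].
have [g lg] := exists_layering (frag F A).
pose Z al be := A `&` [set p | al <= g p <= be].
pose step al be u v := [/\ grid_adj u v, link (frag F A) u v & Z al be v].
(* The margin rho keeps every member used by a jump inside the annulus, where it is not cut. *)
have fill al be u n v : band f m r u -> n <= rho -> reach F n u v ->
    al <= g u - rho -> g u + rho <= be ->
    chain (step al be) u v /\ reach (frag F A) n u v.
  move=> /andP[mu ur] + + alu ube.
  elim: n v => [v _ <-|n IH v n_rho]; first by split=> //; exact: chain0.
  case=> [<-|[u' uu' [s Fs [su' sv]]]]; first by split; [exact: chain0|left].
  have [cu' ru'] := IH u' (ltnW n_rho) uu'.
  have sA : s `<=` A.
    move=> t st; have u't : link F u' t by exists s.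
    have ut : reach F n.+1 u t by right; exists u'.
    have := reach_layering lf ut; have := reach_layering lf (reach_sym ut).
    by rewrite /A /= /a /b; lia.
  have Fs' : frag F A s by split=> //; [exact: Fc|exists s].
  have rs t : s t -> reach (frag F A) n.+1 u t.
    by move=> st; right; exists u' => //; exists s.
  split; last exact: rs.
  apply: chain_trans cu' _.
  have [_] : s v /\ chain (step al be) u' v => //.
  elim: (Fc s Fs u' v su' sv) => [su'2|t t' _ [st u't] tt' st'].
    by split=> //; exact: chain0.
  split=> //; apply: chainS u't _; split=> //; first by exists s.
  have ut := rs t' st'.
  have := reach_layering lg ut; have := reach_layering lg (reach_sym ut).
  by split=> /=; [exact: sA|lia].
(* A jump changes g by at most rho, hence the quotient by at most one; equal parity then means equal
   quotient. *)
exists (fun p => odd (g p %/ rho)) => p q pq.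
have [<-|Bp] : p = q \/ band f m r p.
- by elim: pq => [|u v _ IH [Bu _ _ _]]; [left|right; case: IH => // ->].
- exact: reach_refl.
pose k := g p %/ rho.
have gk u : g u %/ rho = k -> k * rho <= g u < k * rho + rho.
  move=> <-; rewrite leq_divM /=.
  by have := ltn_ceil (g u) rho0; rewrite mulSn addnC.
pose al := k * rho - rho; pose be := k * rho + 2 * rho.
have [_ _ pq'] : [/\ band f m r q, g q %/ rho = k & chain (step al be) p q].
  elim: pq => [|u v _ [_ gu pu] [Bu Bv uv_odd uv]]; first by split=> //; exact: chain0.
  have /andP[gu1 gu2] := gk u gu.
  have [||uv1 uv2] := fill al be u rho v Bu (leqnn _) uv.
  - by rewrite /al; lia.
  - by rewrite /be; lia.
  split=> //; last exact: chain_trans pu uv1.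
  have h1 := reach_layering lg uv2; have h2 := reach_layering lg (reach_sym uv2).
  have := leq_div2r rho h1; have := leq_div2r rho h2.
  rewrite !divnDr ?dvdnn // divnn rho0 /=; move: uv_odd; rewrite gu; lia.
(* With w = 3 rho, the bound 12 w + 18 is at most 54 rho because rho >= 1. *)
have := @walk_bounded F f g a b al be (3 * rho) p q Fc lf lg.
move=> /(_ _ _ _ pq') => H.
apply: reach_le (H _ _ _); rewrite ?/a ?/b ?/al ?/be; try lia.
have /andP[gp1 gp2] := gk p erefl; have /andP[mp pr] := Bp.
by split; rewrite /A /=; lia.
Qed.

(* The band of index l uses the colours l + 1 and l + 2 mod 3, so a monochromatic
   chain stays in two consecutive bands.  The two-colouring of odd bands is made
   at a scale exceeding the size of the pieces in the even bands, so that the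
   passages through the even band do not merge pieces of the odd one. *)
Lemma cell_coloring F r : (forall s, F s -> connected4 s) -> 0 < r ->
  exists2 chi : cell -> nat, (forall p, chi p < 3) &
    forall p q, chain (fun u v => chi u = chi v /\ reach F r u v) p q ->
      reach F (3134 * r) p q.
Proof.
move=> Fc r0; have [f lf] := exists_layering F.
(* A passage through an even band costs a piece of size 54 r and a jump on each side, hence the
   scale 56 r. *)
have r0' : 0 < 56 * r by lia.
have rr : r <= 56 * r by lia.
have [k1 k1P] := choice (fun l => band_coloring (l * r) Fc lf r0 (leqnn r)).
have [k2 k2P] := choice (fun l => band_coloring (l * r) Fc lf r0' rr).
pose l p := f p %/ r.
pose kappa p := if odd (l p) then k2 (l p) p else k1 (l p) p.
pose chi p := (l p + 1 + kappa p) %% 3.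
have lB p : band f (l p * r) r p.
  rewrite /band /= leq_divM /=.
  by have := ltn_ceil (f p) r0; rewrite mulSn addnC.
have lS u v : reach F r u v -> l u <= (l v).+1 /\ l v <= (l u).+1.
  move=> uv; have := reach_layering lf uv; have := reach_layering lf (reach_sym uv).
  move=> /(leq_div2r r) + /(leq_div2r r); rewrite !divnDr ?dvdnn // divnn r0 /=.
  by rewrite /l; lia.
have kap u v : chi u = chi v -> l u = l v -> kappa u = kappa v.
  by rewrite /chi; case: (kappa u) (kappa v) => -[] //=; lia.
pose eE u v := [/\ ~~ odd (l u), ~~ odd (l v), chi u = chi v & reach F r u v].
pose eO u v := [/\ odd (l u), l u = l v, chi u = chi v & reach F (56 * r) u v].
have chainE u v : chain eE u v ->
    [/\ l u = l v, chi u = chi v & reach F (54 * r) u v].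
  move=> uv.
  have H : [/\ l u = l v, chi u = chi v & chain (fun s t => [/\ band f (l u * r) r s,
      band f (l u * r) r t, k1 (l u) s = k1 (l u) t & reach F r s t]) u v].
    elim: uv => [|s t _ [us cus chus] [ds dt cst st]].
      by split=> //; exact: chain0.
    have [st1 st2] := lS _ _ st.
    have lst : l s = l t by lia.
    split; [lia|by rewrite cus|]; apply: chainS chus _; split=> //.
    - by rewrite us; exact: lB.
    - by rewrite us lst; exact: lB.
    - by have := kap _ _ cst lst; rewrite /kappa -lst (negbTE ds) us.
  by case: H => ? ? /k1P.
have chainO u v : chain eO u v ->
    [/\ l u = l v, chi u = chi v & reach F (54 * (56 * r)) u v].
  move=> uv.
  have H : [/\ l u = l v, chi u = chi v & chain (fun s t => [/\ band f (l u * r) r s,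
      band f (l u * r) r t, k2 (l u) s = k2 (l u) t & reach F (56 * r) s t]) u v].
    elim: uv => [|s t _ [us cus chus] [ds lst cst st]].
      by split=> //; exact: chain0.
    split; [lia|by rewrite cus|]; apply: chainS chus _; split=> //.
    - by rewrite us; exact: lB.
    - by rewrite us lst; exact: lB.
    - by have := kap _ _ cst lst; rewrite /kappa -lst ds us.
  by case: H => ? ? /k2P.
exists chi => [p|p q pq]; first by rewrite ltn_mod.
(* [st1]: the chain has stayed in an even band. [st2]: it has come to [d1] in an odd band, moved to
   [d2] at scale 56 r, and possibly begun an excursion into an even band. *)
pose st1 q := ~~ odd (l q) /\ chain eE p q.
pose st2 q := exists d1 d2, [/\ reach F (55 * r) p d1, odd (l d2), chain eO d1 d2 &
  q = d2 \/ exists q', [/\ reach F r d2 q', chi d2 = chi q', ~~ odd (l q') &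
                          chain eE q' q]].
(* Three consecutive bands thus have no common colour, so an excursion into an even band returns to
   the odd band it came from. *)
have chi_l u : chi u < 3 /\ chi u != l u %% 3.
  by rewrite /chi; split; [|case: (kappa u)]; lia.
suff [[_ /chainE[_ _]]|[d1 [d2 [po1 _ /chainO[_ _ oo12] qo2]]]] : st1 q \/ st2 q.
- by apply: reach_le; lia.
- have o2q : reach F (55 * r) d2 q.
    case: qo2 => [->|[q' [dq' _ _ /chainE[_ _ q'q]]]]; first exact: reach_refl.
    by apply: reach_le_trans dq' q'q _; lia.
  (* 55 + 54 * 56 + 55 = 3134. *)
  by apply: reach_le_trans (reach_trans po1 oo12) o2q _; lia.
elim: pq => [|q' v _ IH [cqv qv]] {q}.
  have [dp|dp] := boolP (odd (l p)); last by left; split=> //; exact: chain0.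
  by right; exists p, p; split=> //; [exact: reach_refl|exact: chain0|left].
have [lv1 lv2] := lS _ _ qv.
have [dv|dv] := boolP (odd (l v)).
  right; case: IH => [[eq' pq']|[d1 [d2 [po1 oo2 oo12 [eo|[q [dq coq eq' qq']]]]]]].
  - exists v, v; split=> //; [|exact: chain0|by left].
    by have [_ _ pq''] := chainE _ _ pq'; apply: reach_le_trans pq'' qv _; lia.
  - subst q'; exists d1, v; split=> //; last by left.
    apply: chainS oo12 _; split=> //; first by lia.
    by apply: reach_le qv; lia.
  - exists d1, v; split=> //; last by left.
    have [lqq' cqq' rqq'] := chainE _ _ qq'.
    have [lo1 lo2] := lS _ _ dq.
    apply: chainS oo12 _; split=> //.
    + have [c2 n2] := chi_l d2; have [cq nq] := chi_l q'; have [cv nv] := chi_l v.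
      by rewrite coq cqq' cqv in n2; rewrite cqv in nq; lia.
    + by rewrite coq cqq'.
    + by apply: reach_le_trans (reach_trans dq rqq') qv _; lia.
case: IH => [[eq' pq']|[d1 [d2 [po1 oo2 oo12 [eo|[q [dq coq eq' qq']]]]]]].
- by left; split=> //; apply: chainS pq' _.
- subst q'; right; exists d1, d2; split=> //; right; exists v; split=> //.
  exact: chain0.
- right; exists d1, d2; split=> //; right; exists q; split=> //.
  have [lqq' _ _] := chainE _ _ qq'.
  by apply: chainS qq' _; split=> //; rewrite -lqq'.
Qed.

(** * From strings to cells *)

Local Open Scope ring_scope.

Lemma within_continuous_ball (R : realType) (g : R -> R * R) (A : set R) t d :
  {within A, continuous g} -> A t -> 0 < d ->
  exists2 e, 0 < e & forall s, A s -> ball t e s -> ball (g t) d (g s).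
Proof.
move=> /subspace_continuousP/[apply] /cvg_ballP H /H.
rewrite near_withinE => /nbhs_ballP[e /= e0 He].
by exists e => // s As ts; apply: He.
Qed.

Lemma near_right0 (R : realType) (P : R -> Prop) (e : R) : 0 < e ->
  (forall e', 0 < e' < e -> P e') -> \forall e' \near (0 : R)^'+, P e'.
Proof.
move=> e0 He; near=> e'; apply: He; apply/andP; split.
  by near: e'; exact: nbhs_right_gt.
by near: e'; exact: nbhs_right_lt.
Unshelve. all: by end_near. Qed.

(** Near-covering compactness of the interval, with [e] tending to 0 from the right as parameter,
    makes the local moduli uniform. *)
Lemma path_unif_continuous (R : realType) (g : R -> R * R) (d : R) :
  {within `[0, 1], continuous g} -> 0 < d ->
  exists2 e : R, 0 < e & forall s t : R, `[0, 1]%classic s -> `[0, 1]%classic t ->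
    ball s e t -> ball (g s) d (g t).
Proof.
move=> cg d0; pose I := `[0 : R, 1]%classic.
have /compact_near_coveringP/near_covering_withinP cI := @segment_compact R 0 1.
have := cI R (0:R)^'+ (fun e s => forall t, I t -> ball s e t -> ball (g s) d (g t)) _.
case=> [|e /= e0 He].
  move=> s Is; have d2 : 0 < d / 2 by rewrite divr_gt0.
  have [e e0 He] := within_continuous_ball cg Is d2.
  have e2 : 0 < e / 2 by rewrite divr_gt0.
  exists (ball s (e / 2), [set x | 0 < x < e / 2]) => /=.
    split; first exact: nbhsx_ballx.
    by apply: (near_right0 e2).
  move=> [s' e'] /= [ss' /andP[e'0 e'e]] Is' t It s't.
  rewrite [d]splitr; apply: (@ball_triangle _ _ (g s)).
    by apply/ball_sym/He => //; apply: le_ball ss'; lra.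
  apply: He => //; rewrite [e]splitr; apply: ball_triangle ss' _.
  by apply: le_ball s't; exact: ltW.
exists (e / 2); first by rewrite divr_gt0.
move=> s t Is It st; apply: (He (e / 2)) => //=; last by rewrite divr_gt0.
by rewrite sub0r normrN gtr0_norm ?divr_gt0 // ltr_pdivrMr // ltr_pMr //; lra.
Qed.

(** The same compactness argument on the product of the two intervals. *)
Lemma paths_separated (R : realType) (g h : R -> R * R) :
  {within `[0, 1], continuous g} -> {within `[0, 1], continuous h} ->
  (forall s t : R, `[0, 1]%classic s -> `[0, 1]%classic t -> g s <> h t) ->
  \forall e \near (0:R)^'+, forall s t : R, `[0, 1]%classic s -> `[0, 1]%classic t ->
    ~ ball (g s) e (h t).
Proof.
move=> cg ch gh; pose I := `[0 : R, 1]%classic.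
have /compact_near_coveringP/near_covering_withinP cI :=
  compact_setX (@segment_compact R 0 1) (@segment_compact R 0 1).
have := cI R (0:R)^'+ (fun e st => ~ ball (g st.1) e (h st.2)) _.
case=> [|e /= e0 He].
  move=> [s t] [/= Is It].
  have [d d0 nd] : exists2 d : R, 0 < d & ~ ball (g s) d (h t).
    have := gh s t Is It; case: (g s) (h t) => [a b] [a' b'] ab.
    have [aa'|aa'] := eqVneq a a'; last first.
      exists `|a - a'|; first by rewrite normr_gt0 subr_eq0.
      by move=> [/=]; rewrite /ball /= ltxx.
    have [bb'|bb'] := eqVneq b b'; first by rewrite aa' bb' in ab.
    exists `|b - b'|; first by rewrite normr_gt0 subr_eq0.
    by move=> [_ /=]; rewrite /ball /= ltxx.
  have d3 : 0 < d / 3 by rewrite divr_gt0.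
  have [e1 e10 He1] := within_continuous_ball cg Is d3.
  have [e2 e20 He2] := within_continuous_ball ch It d3.
  exists (ball s e1 `*` ball t e2, [set x | 0 < x < d / 3]) => /=.
    split; last by apply: (near_right0 d3).
    by exists (ball s e1, ball t e2) => //=; split; exact: nbhsx_ballx.
  move=> [[s' t'] e'] /= [[ss' tt'] /andP[e'0 e'd]] [Is' It'] b.
  apply: nd; have -> : d = d / 3 + (d / 3 + d / 3) by lra.
  apply: ball_triangle (He1 _ Is' ss') _.
  apply: (@ball_triangle _ _ (h t')); first by apply: le_ball b; exact: ltW.
  by apply: ball_sym; exact: He2.
apply: (near_right0 e0) => e' /andP[e'0 e'e] s t Is It.
apply: (He e' _ _ (s, t)) => //=.
by rewrite sub0r normrN gtr0_norm.
Qed.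

Definition cell_of (R : realType) (d : R) (p : R * R) : cell :=
  (Num.floor (p.1 / d), Num.floor (p.2 / d)).

(** The 3 by 3 square holds the cells of all points within one mesh width, and two blocks that meet
    have centres at most 2 apart in each coordinate. *)
Definition block (z : cell) : set cell :=
  [set k | `|k.1 - z.1| <= 1 /\ `|k.2 - z.2| <= 1].

Lemma floor_near (R : realType) (d x y : R) : 0 < d -> `|x - y| < d ->
  `|Num.floor (x / d) - Num.floor (y / d)| <= 1.
Proof.
move=> d0 xy; have /andP[x1 x2] := floor_itv (x / d).
have /andP[y1 y2] := floor_itv (y / d).
have : `|x / d - y / d| < 1.
  by rewrite -mulrBl normrM normfV (gtr0_norm d0) ltr_pdivrMr ?mul1r.
rewrite ltr_norml => /andP[h1 h2].
have a1 : ((Num.floor (x / d))%:~R : R) < (Num.floor (y / d) + 2)%:~R.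
  by rewrite !intrD in y2 *; lra.
have a2 : ((Num.floor (y / d))%:~R : R) < (Num.floor (x / d) + 2)%:~R.
  by rewrite !intrD in x2 *; lra.
rewrite !ltr_int in a1 a2; lia.
Qed.

Lemma near_floor (R : realType) (d x y : R) : 0 < d ->
  `|Num.floor (x / d) - Num.floor (y / d)| <= 2 -> `|x - y| < 3 * d.
Proof.
move=> d0 xy; have /andP[x1 x2] := floor_itv (x / d).
have /andP[y1 y2] := floor_itv (y / d).
suff : `|x / d - y / d| < 3.
  by rewrite -mulrBl normrM normfV (gtr0_norm d0) ltr_pdivrMr.
have a1 : ((Num.floor (x / d))%:~R : R) <= (Num.floor (y / d) + 2)%:~R.
  by rewrite ler_int; lia.
have a2 : ((Num.floor (y / d))%:~R : R) <= (Num.floor (x / d) + 2)%:~R.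
  by rewrite ler_int; lia.
rewrite !intrD in a1 a2 x2 y2; rewrite ltr_norml; apply/andP; split; lra.
Qed.

Lemma ball_block (R : realType) (d : R) (p q : R * R) : 0 < d -> ball p d q ->
  block (cell_of d p) (cell_of d q).
Proof.
move=> d0 [p1 p2]; split=> /=; rewrite distrC; exact: floor_near.
Qed.

Lemma block_ball (R : realType) (d : R) (p q : R * R) k : 0 < d ->
  block (cell_of d p) k -> block (cell_of d q) k -> ball p (3 * d) q.
Proof.
case: p q k => [p1 p2] [q1 q2] [k1 k2] d0 [/= p1k p2k] [/= q1k q2k].
by split; apply: near_floor => //=; lia.
Qed.

Lemma block_joined z k : block z k -> joined (block z) z k.
Proof.
case: z k => [x y] [x' y'] [/= hx hy].
have xy : block (x, y) (x', y) by split=> /=; lia.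
apply: (@joined_trans _ (x', y)).
  have [->|xx'] := eqVneq x' x; first by apply: joined0; split=> /=; lia.
  apply: joinedS (joined0 _) _ xy; first by split=> /=; lia.
  by rewrite /grid_adj /=; lia.
have [->|yy'] := eqVneq y' y; first exact: joined0.
by apply: joinedS (joined0 xy) _ _; [rewrite /grid_adj /=; lia|split].
Qed.

Lemma path_cells_joined (R : realType) (g : R -> R * R) (d : R) (C : set cell) t :
  {within `[0, 1], continuous g} -> 0 < d ->
  (forall s : R, `[0, 1]%classic s -> block (cell_of d (g s)) `<=` C) ->
  `[0, 1]%classic t -> joined C (cell_of d (g 0)) (cell_of d (g t)).
Proof.
move=> cg d0 gC It; have [e e0 He] := path_unif_continuous cg d0.
have C0 z : block z z by case: z => x y; split=> /=; lia.
have e2 : 0 < e / 2 by rewrite divr_gt0.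
have [n tn] : exists n : nat, t <= n%:R * (e / 2).
  exists (Num.bound (t / (e / 2))); rewrite -ler_pdivrMr //.
  apply/ltW/archi_boundP; apply: divr_ge0; last exact: ltW.
  by move: It; rewrite /= in_itv /= => /andP[].
elim: n t It tn => [|n IH] t It tn.
  have -> : t = 0 by move: It tn; rewrite /= in_itv /= mul0r; lra.
  by apply: joined0; apply: gC (C0 _); rewrite /= in_itv /=; lra.
(* Steps of e / 2 stay strictly inside the modulus [e]. *)
pose t' := Num.max 0 (t - e / 2).
have It' : `[0, 1]%classic t'.
  by move: It; rewrite /= !in_itv /= le_max lexx /= ge_max; lra.
apply: (@joined_trans _ (cell_of d (g t'))).
  apply: IH => //; rewrite ge_max mulr_ge0 ?(ltW e2) //=.
  by rewrite mulrSr mulrDl mul1r in tn; lra.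
apply: joined_sub (gC _ It') _; apply: block_joined; apply: ball_block => //.
apply: He => //; rewrite /ball /= ltr_norml.
have [tt'|tt'] : t' = 0 /\ t <= e / 2 \/ t' = t - e / 2.
- rewrite /t'; have [H|H] := leP 0 (t - e / 2); [by right|left; split=> //; lra].
- by move: It; rewrite /= in_itv /=; lra.
- by lra.
Qed.

Lemma near_seq (T : eqType) (I : Type) (F : set_system I) (s : seq T)
    (P : T -> I -> Prop) : Filter F ->
  (forall x, x \in s -> \forall i \near F, P x i) ->
  \forall i \near F, forall x, x \in s -> P x i.
Proof.
move=> FF; elim: s => [|x s IH] H; first exact: nearW.
have H1 := H x (mem_head _ _).
have H2 : \forall i \near F, forall y, y \in s -> P y i.
  by apply: IH => y ys; apply: H; rewrite inE ys orbT.
near=> i => y; rewrite inE => /predU1P[->|]; first by near: i.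
by move: y; near: i.
Unshelve. all: by end_near. Qed.

Definition meets (T : Type) (A B : set T) := A `&` B !=set0.

(** Each string is replaced by the cells near finitely many of its paths, from a base point to
    chosen points of intersection. Paths in disjoint strings keep a positive distance, and a mesh of
    one third of it creates no new intersections. *)
Lemma discretization (R : realType) (V : eqType) (S : V -> set (R * R))
    (F : seq V) : (forall v, path_connected R (S v)) ->
  exists c : V -> set cell, [/\ forall v, connected4 (c v),
    {in F &, forall u v, meets (S u) (S v) -> meets (c u) (c v)} &
    {in F &, forall u v, meets (c u) (c v) -> meets (S u) (S v)}].
Proof.
move=> pcS; pose I := `[0 : R, 1]%classic.
pose q u v := xget (0, 0) (S u `&` S v).
have qP u v : meets (S u) (S v) -> (S u `&` S v) (q u v).
  by move=> [x Sx]; apply: xgetPex; exists x.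
pose b u := q u u.
(* With both choices of [i] available, [c u] and [c v] both contain the cell of [q u v]. *)
pose pt u v (i : bool) := if i then q u v else q v u.
pose isg u v i g := [/\ {within I, continuous g}, g 0 = b u, g 1 = pt u v i &
  g @` I `<=` S u].
pose g u v i := xget (fun=> (0, 0)) (isg u v i).
have gP u v i : meets (S u) (S v) -> isg u v i (g u v i).
  move=> uv; rewrite /g; apply: xgetPex; have [Suq Svq] := qP u v uv.
  apply: pcS.
    by have [] : (S u `&` S u) (b u) by apply: qP; exists (q u v).
  rewrite /pt; case: i => //.
  by have [] : (S v `&` S u) (q v u) by apply: qP; exists (q u v).
have I0 : I 0 by rewrite /I /= in_itv /=; lra.
have I1 : I 1 by rewrite /I /= in_itv /=; lra.
have sep : \forall e \near (0 : R)^'+, forall u, u \in F -> forall v, v \in F ->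
    forall u', u' \in F -> forall v', v' \in F ->
    forall i, i \in [:: true; false] -> forall i', i' \in [:: true; false] ->
    meets (S u) (S v) -> meets (S u') (S v') -> ~ meets (S u) (S u') ->
    forall s t, I s -> I t -> ~ ball (g u v i s) e (g u' v' i' t).
  apply: near_seq => u _; apply: near_seq => v _; apply: near_seq => u' _.
  apply: near_seq => v' _; apply: near_seq => i _; apply: near_seq => i' _.
  have [uv|] := pselect (meets (S u) (S v)); last by move=> nuv; apply: nearW.
  have [uv'|] := pselect (meets (S u') (S v')); last by move=> nuv; apply: nearW.
  have [uu'|uu'] := pselect (meets (S u) (S u')); first by apply: nearW.
  have [cg _ _ gS] := gP u v i uv; have [cg' _ _ gS'] := gP u' v' i' uv'.
  have := @paths_separated R (g u v i) (g u' v' i') cg cg'.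
  case=> [s t Is It st|e e0 He].
    apply: uu'; exists (g u v i s); split.
      by apply: gS; exists s.
    by rewrite st; apply: gS'; exists t.
  by exists e => // e' ee' e'0 _ _ _; apply: He.
have [e /= e0 {}sep] : exists2 e : R, 0 < e & forall u v u' v' i i' s t,
    u \in F -> v \in F -> u' \in F -> v' \in F -> 
    meets (S u) (S v) -> meets (S u') (S v') -> ~ meets (S u) (S u') ->
    I s -> I t -> ~ ball (g u v i s) e (g u' v' i' t).
  case: sep => e /= e0 He; exists (e / 2); first by rewrite divr_gt0.
  move=> u v u' v' i i' s t uF vF u'F v'F uv uv' uu' Is It.
  apply: (He (e / 2)) => //; rewrite ?inE ?orbb; last first.
  - by case: i'.
  - by case: i.
  - by rewrite divr_gt0.
  by rewrite /= sub0r normrN gtr0_norm ?divr_gt0 //; lra.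
pose d := e / 3; have d0 : 0 < d by rewrite divr_gt0.
pose c u := [set k | exists v i t, [/\ v \in F, meets (S u) (S v), I t &
  block (cell_of d (g u v i t)) k]].
have gc u v i t : v \in F -> meets (S u) (S v) -> I t ->
    block (cell_of d (g u v i t)) `<=` c u.
  by move=> vF uv It k bk; exists v, i, t.
have C0 z : block z z by case: z => x y; split=> /=; lia.
exists c; split.
- move=> u k k' ck ck'.
  have H j : c u j -> joined (c u) (cell_of d (b u)) j.
    move=> [v [i [t [vF uv It bj]]]]; have [cg g0 _ _] := gP u v i uv.
    apply: (@joined_trans _ (cell_of d (g u v i t))).
      by rewrite -g0; apply: path_cells_joined => // s Is; exact: gc.
    by apply: joined_sub (block_joined bj); exact: gc.
  by apply: joined_trans (H _ ck'); apply: joined_sym; exact: H.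
- move=> u v uF vF uv; exists (cell_of d (q u v)); split.
    apply: (gc u v true 1) => //; have [_ _ -> _] := gP u v true uv.
    exact: C0.
  have vu : meets (S v) (S u) by rewrite /meets setIC.
  apply: (gc v u false 1) => //; have [_ _ -> _] := gP v u false vu.
  exact: C0.
- move=> u v uF vF [k [[u' [i [s [u'F uu' Is bk]]]] [v' [i' [t [v'F vv' It bk']]]]]].
  apply: contrapT => uv; apply: (sep u u' v v' i i' s t) => //.
  have -> : e = 3 * d by rewrite /d; lra.
  exact: block_ball bk bk'.
Qed.

(** * Colourings of string graphs *)

Local Open Scope nat_scope.

Definition greach (V : Type) (e : rel V) n (u v : V) :=
  exists p, [/\ path e u p, last u p = v & size p <= n].

Lemma greach_refl V (e : rel V) n u : greach e n u u.
Proof. by exists [::]. Qed.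

Lemma greach_trans V (e : rel V) m n u v w :
  greach e m u v -> greach e n v w -> greach e (m + n) u w.
Proof.
move=> [p [up <- pm]] [q [vq <- qn]]; exists (p ++ q).
by rewrite cat_path up vq last_cat size_cat leq_add.
Qed.

Lemma greach_sym V (e : rel V) n u v : symmetric e ->
  greach e n u v -> greach e n v u.
Proof.
move=> se [p [up <- pn]]; exists (rev (belast u p)).
split; last by rewrite size_rev size_belast.
  by rewrite rev_path (eq_path (e' := e)) // => a b; rewrite se.
by case: p {up pn} => //= a p; rewrite rev_cons last_rcons.
Qed.

Definition weak_diameter_coloring (V : Type) (e : rel V) n M (D : set V)
    (chi : V -> nat) :=
  (forall v, chi v < 3) /\ forall u v,
    chain (fun a b => [/\ D a, D b, chi a = chi b & greach e n a b]) u v ->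
    greach e M u v.

Lemma finite_coloring (R : realType) (V : choiceType) (e : rel V)
    (S : V -> set (R * R)) (D : seq V) n :
  (forall v, path_connected R (S v)) ->
  (forall u v, e u v -> meets (S u) (S v)) ->
  (forall u v, meets (S u) (S v) -> u = v \/ e u v) ->
  exists chi, weak_diameter_coloring e n (3134 * n.+1).+1 [set v | v \in D] chi.
Proof.
move=> pcS eS Se.
pose walks a b := [set p | [/\ path e a p, last a p = b & size p <= n]].
pose W a b := xget [::] (walks a b).
have WP a b : greach e n a b -> walks a b (W a b).
  by move=> [p Hp]; apply: xgetPex; exists p.
(* Walks that realise the jumps may leave [D], so their vertices are added. *)
pose D1 := D ++ flatten [seq flatten [seq W a b | b <- D] | a <- D].
have sD : {subset D <= D1} by move=> x Dx; rewrite mem_cat Dx.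
have WD a b : a \in D -> b \in D -> {subset W a b <= D1}.
  move=> aD bD x xW; rewrite mem_cat; apply/orP; right.
  apply/flattenP; exists (flatten [seq W a b | b <- D]).
    by apply/mapP; exists a.
  by apply/flattenP; exists (W a b) => //; apply/mapP; exists b.
have [c [cc cS Sc]] := discretization D1 pcS.
pose Fam := c @` [set v | v \in D1].
have Fc s : Fam s -> connected4 s by move=> [v _ <-].
have [chi chi3 chiP] := cell_coloring Fc (ltn0Sn n).
pose pv v := xget (0%R, 0%R) (c v).
have pvP v : c v !=set0 -> c v (pv v) by move=> [k ck]; apply: xgetPex; exists k.
have lk v p q : v \in D1 -> c v p -> c v q -> reach Fam 1 p q.
  by move=> vD cp cq; apply: link_reach; exists (c v) => //; exists v.
have walk a l p q : a \in D1 -> {subset l <= D1} -> path e a l -> c a p ->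
    c (last a l) q -> reach Fam (size l).+1 p q.
  elim: l a p => [|b l IH] a p aD lD /=; first by move=> _; exact: lk.
  move=> /andP[ab bl] cp cq; have bD : b \in D1 by apply: lD; rewrite mem_head.
  have [m [ma mb]] := cS a b aD bD (eS _ _ ab).
  rewrite -addn1 addnC; apply: reach_trans (lk a p m aD cp ma) _.
  by apply: (IH b) => // x xl; apply: lD; rewrite inE xl orbT.
have ends a b l : a \in D1 -> {subset b :: l <= D1} -> path e a (b :: l) ->
    c (last a (b :: l)) !=set0.
  elim: l a b => [|b' l IH] a b aD lD /= /andP[ab bl]; last first.
    by apply: (IH b b') => // [|x xl]; apply: lD; rewrite ?mem_head // inE xl orbT.
  by have [m [_ mb]] := cS a b aD (lD _ (mem_head _ _)) (eS _ _ ab); exists m.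
(* At most m members are passed between [u] and [v], and successive ones are equal or adjacent: m +
   1 edges suffice. *)
have back m p q u v : u \in D1 -> v \in D1 -> c u p -> c v q ->
    reach Fam m p q -> greach e m.+1 u v.
  move=> uD; elim: m q v => [|m IH] q v vD cp cq.
    move=> pq; have {}pq : p = q := pq; subst q.
    have [|->|uv] := Se u v; first by apply: Sc => //; exists p.
      exact: greach_refl.
    by exists [:: v]; rewrite /= uv.
  case=> [pq|[p' pp' [_ [x xD <-] [cp' cxq]]]].
    subst q; have := IH p v vD cp cq (reach_refl _ _ _).
    by case=> l [? ? ?]; exists l; split=> //; lia.
  have ux := IH p' x xD cp cp' pp'.
  rewrite -addn1; apply: greach_trans ux _.
  have [|->|xv] := Se x v; first by apply: Sc => //; exists q.
    exact: greach_refl.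
  by exists [:: v]; rewrite /= xv.
exists (chi \o pv); split=> [v|u v uv]; first exact: chi3.
(* A vertex without cells has a default representative but no neighbour in [D1], so only trivial
   jumps start there. Otherwise n edges pass through n + 1 strings, hence [n.+1]. *)
have step a b : a \in D -> b \in D -> greach e n a b ->
    a = b \/ [/\ c a !=set0, c b !=set0 & reach Fam n.+1 (pv a) (pv b)].
  move=> aD bD /WP[]; have := WD a b aD bD; case: (W a b) => [|x l] lD.
    by left.
  move=> pl lb sl; right.
  have ca : c a !=set0.
    have /= /andP[ax _] := pl.
    have [] := cS a x (sD _ aD) (lD _ (mem_head _ _)) (eS _ _ ax).
    by move=> m [ma _]; exists m.
  have cb : c b !=set0.
    by rewrite -lb; exact: ends (sD _ aD) lD pl.
  split=> //; apply: reach_le (walk a (x :: l) _ _ (sD _ aD) lD pl _ _) => //.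
    exact: pvP.
  by rewrite lb; exact: pvP.
have [->|[uD vD cu cv cuv]] : u = v \/ [/\ u \in D, v \in D, c u !=set0, c v !=set0 &
    chain (fun s t => chi s = chi t /\ reach Fam n.+1 s t) (pv u) (pv v)].
- elim: uv => [|a b _ IH [/= aD bD cab /(step _ _ aD bD)[<-//|[ca cb ab]]]].
    by left.
  right; case: IH => [->|[uD _ cu _ ua]]; split=> //.
    by apply: chainS (chain0 _ _) _.
  by apply: chainS ua _.
- exact: greach_refl.
- by apply: back (sD _ uD) (sD _ vD) (pvP _ cu) (pvP _ cv) (chiP _ _ cuv).
Qed.

(** The colour of a vertex is its limit along an ultrafilter on the finite sets. A chain involves
    finitely many vertices, so it is also a monochromatic chain for the colouring of some finite set
    containing them. *)
Lemma coloring_compactness (V : Type) (e : rel V) n M :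
  (forall D : seq {classic V}, exists chi,
     weak_diameter_coloring e n M [set v | v \in D] chi) ->
  exists chi, weak_diameter_coloring e n M setT chi.
Proof.
move=> /choice[chi_ chiP].
pose B (D : seq {classic V}) := [set L : seq {classic V} | {subset D <= L}].
have PF : ProperFilter (filter_from setT B).
  apply: filter_from_proper; last by move=> D _; exists D.
  apply: filter_from_filter; first by exists [::].
  move=> D D' _ _; exists (D ++ D') => // L HL.
  by split=> x xD; apply: HL; rewrite mem_cat xD ?orbT.
have [U [UU BU]] := ultraFilterLemma PF.
have FU : Filter U by exact: filter_filter.
have Uin v : U [set L : seq {classic V} | (v : {classic V}) \in L].
  by apply: BU; exists [:: v] => // L; apply; rewrite mem_head.
have /choice[chi chiU] v : exists i, U [set L | chi_ L v = i] /\ i < 3.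
  have [?|n0] := in_ultra_setVsetC [set L | chi_ L v = 0] UU; first by exists 0.
  have [?|n1] := in_ultra_setVsetC [set L | chi_ L v = 1] UU; first by exists 1.
  have [?|n2] := in_ultra_setVsetC [set L | chi_ L v = 2] UU; first by exists 2.
  have [L [[/= h0 h1] h2]] := filter_ex (filterI (filterI n0 n1) n2).
  by have [/(_ v) + _] := chiP L; lia.
exists chi; split=> [v|u v uv]; first by case: (chiU v).
suff /filter_ex[L HL] : U [set L | chain (fun a b => [/\ (a : {classic V}) \in L,
    (b : {classic V}) \in L, chi_ L a = chi_ L b & greach e n a b]) u v].
  by have [_] := chiP L; apply.
elim: uv => [|a b _ IH [_ _ cab ab]].
  by apply: filterS filterT => L _; exact: chain0.
have Uc v := @filterI _ U FU _ _ (Uin v) (chiU v).1.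
have := @filterI _ U FU _ _ IH (@filterI _ U FU _ _ (Uc a) (Uc b)).
apply: filterS => L [HL [[aL ca] [bL cb]]].
by apply: chainS HL _; split=> //; rewrite /= in ca cb; rewrite ca cb.
Qed.

Local Open Scope ring_scope.

Lemma string_graph_coloring (R : realType) (S : graph) : string_graph R S ->
  exists K : nat, forall n, exists chi,
    weak_diameter_coloring (@adj S) n (K * n.+1).+1 setT chi.
Proof.
move=> [C pcC [f [f' fK f'K] fadj]]; exists 3134%N => n.
apply: coloring_compactness => D.
pose St (v : {classic S}) := sval (f v).
apply: (@finite_coloring R {classic S} (@adj S) St).
- by move=> v; apply: pcC; exact: (svalP (f v)).
- by move=> u v; rewrite -fadj => /asboolP[].
- move=> u v uv; have [->|fuv] := pselect (u = v); first by left.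
  right; rewrite -fadj; apply/asboolP; split=> //.
  by move=> /(congr1 f'); rewrite !fK.
Qed.

(** * Covers from colourings *)

Lemma greach_dist (R : realType) (S : graph) n (u v : S) :
  greach (@adj S) n u v -> (graph_dist R u v <= n%:R%:E)%E.
Proof.
move=> [p [up pv pn]]; apply: (@le_trans _ _ (size p)%:R%:E).
  by apply: ereal_inf_lbound; exists p.
by rewrite lee_fin ler_nat.
Qed.

Lemma dist_greach (R : realType) (S : graph) (u v : S) (r : R) :
  (graph_dist R u v <= r%:E)%E -> greach (@adj S) (Num.truncn r) u v.
Proof.
have [->|[p [up pv] <-]] := graph_dist_attained R u v; first by rewrite leye_eq.
rewrite lee_fin => pr; exists p; split=> //.
by rewrite truncn_ge_nat // (le_trans _ pr).
Qed.

Theorem theorem1p2 (R : realType) (S : graph) (hS : string_graph R S) :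
  assouad_nagata_dim_le (graph_emetric R S) 2.
Proof.
have [K Kchi] := string_graph_coloring hS.
have K0 : 0 <= K%:R :> R by exact: ler0n.
(* Classes have diameter at most K (n + 1) + 1 with n <= 2 r, which for r >= 1 is at most 3 K r +
   r. *)
exists (3 * K%:R + 1) => [|r r0]; first by lra.
(* Below scale 1, balls are single vertices and singletons form the cover. *)
have [r1|r1] := ltP r 1.
  exists (range (fun v : S => [set v])); split.
  - by apply/seteqP; split=> // v _; exists [set v] => //; exists v.
  - move=> _ [v _ <-]; apply: ub_ereal_sup => _ [x -> [y -> <-]].
    rewrite (iffRL (@edist_eq0 R (graph_emetric R S) v v) erefl) lee_fin.
    apply: mulr_ge0; last exact: ltW.
    by lra.
  - move=> x; apply: (@card_le_trans _ _ _ ((fun=> [set x]) @` `I_3)); last first.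
      exact: card_image_le.
    apply: subset_card_le => A [[v _ <-] [_ [-> xv]]]; exists 0%N => //.
    have [p [_ <- ps]] := dist_greach xv.
    have tr : (Num.truncn r < 1)%N by rewrite truncn_lt_nat // ltW.
    by have := leq_ltn_trans ps tr; case: p {ps}.
(* Two points of a ball of radius r are at distance at most 2 r, so those of equal colour are one
   jump apart. *)
pose n := Num.truncn (2 * r).
have [chi [chi3 chiP]] := Kchi n.
pose e (a b : S) := [/\ True, True, chi a = chi b & greach (@adj S) n a b].
have e_sym a b : e a b -> e b a.
  by move=> [_ _ cab ab]; split=> //; apply: greach_sym ab; exact: adj_sym.
have nr : n%:R <= 2 * r by rewrite truncn_le; lra.
exists (range (chain e)); split.
- by apply/seteqP; split=> // v _; exists (chain e v); [exists v|exact: chain0].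
- move=> _ [v _ <-]; apply: ub_ereal_sup => _ [x vx [y vy <-]].
  have /chiP/greach_dist/le_trans : chain e x y.
    by apply: chain_trans vy; exact: chain_sym vx.
  apply; rewrite lee_fin -addn1 natrD natrM -[n.+1]addn1 natrD.
  have : K%:R * (n%:R + 1) <= K%:R * (3 * r) by apply: ler_wpM2l => //; lra.
  by lra.
(* [G i] is the only class of colour i that meets the ball, or is empty if there is none. *)
- move=> x; pose G i := [set u | exists a, [/\ ecball x r a, chi a = i & chain e a u]].
  apply: (@card_le_trans _ _ _ (G @` `I_3)); last exact: card_image_le.
  apply: subset_card_le => A [[v _ <-] [a [va xa]]].
  exists (chi a) => /=; first exact: chi3.
  apply/seteqP; split=> u.
    move=> [b [xb cb bu]]; apply: chain_trans va _; apply: chain_trans bu.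
    apply: chainS (chain0 _ _) _; split=> //.
    apply: (@dist_greach R); apply: le_trans (@graph_dist_triangle R S a x b) _.
    rewrite graph_dist_sym (_ : 2 * r = r + r); last by lra.
    by rewrite EFinD; apply: leeD.
  by move=> vu; exists a; split=> //; apply: chain_trans vu; exact: chain_sym va.
Qed.
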